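(* (a) Suppose that there exists a constant $t_0 \geq 1$ such that every $t_0$-tough graph is Hamiltonian. Then there exist positive constants $c_1 = c_1(t_0)$ and $c_2 = c_2(t_0)$ such that the following holds. Let $G$ be an $n$-vertex graph with minimum degree $k$. If $\alpha(G) \leq c_2 k$, then $G \cup \mathbb{G}(n,p)$ is a.a.s. pancyclic whenever $p \geq \frac{c_1 \log n}{nk}$. (b) For every sufficiently large integer $n$, constant $0 < \varepsilon < 1/2$, integer $n^{\varepsilon} \leq k \leq n^{1-\varepsilon}$, and constant $0 < c < 1$, there exist a constant $c' > 0$ and an $n$-vertex graph $H$ with $\delta(H) = k$ and $\alpha(H) \leq ck$ such that $H \cup \mathbb{G}(n,p)$ is a.a.s. not Hamiltonian whenever $p := p(n) \leq \frac{c' \log n}{nk}$. (c) For every sufficiently large integer $n$ and every integer $k := k(n) \leq n/2$ with $k \to \infty$ as $n \to \infty$, there exists an $n$-vertex graph $H$ with $\alpha(H) = k$ and $\delta(H) \geq k/2$ such that $H \cup \mathbb{G}(n,p)$ is a.a.s. not Hamiltonian whenever $p := p(n) \leq \frac{1}{3n}$.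
   Context: A graph $G$ is $t$-tough if for every $S \subseteq V(G)$ the number of connected components of $G \setminus S$ is at most $\max\{1, |S|/t\}$. For an $n$-vertex graph $G$, $G \cup \mathbb{G}(n,p)$ denotes the union $G \cup R$ where $R$ is the binomial random graph on the vertex set $V(G)$ in which each pair of vertices is an edge independently with probability $p$. ''A.a.s.'' means with probability tending to $1$ as $n \to \infty$. $\alpha$ is the independence number and $\delta$ the minimum degree. Hamiltonian: has a cycle through all vertices; pancyclic: has a cycle of every length from $3$ to the number of vertices. *)

(* Defs.v *)
From HB Require Import structures.
From mathcomp Require Import all_boot all_order all_algebra.
From mathcomp Require Import all_classical all_reals all_analysis.
Set Implicit Arguments. Unset Strict Implicit. Unset Printing Implicit Defensive.
Import Order.TTheory GRing.Theory Num.Theory.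
Import numFieldNormedType.Exports.
Local Open Scope ring_scope.

Definition pairs (n : nat) : {set {set 'I_n}} := [set e : {set 'I_n} | #|e| == 2%N].
Definition graph (n : nat) := {set {set 'I_n}}.
Definition simple_graph (n : nat) (E : graph n) : bool := E \subset pairs n.

Definition adj (n : nat) (E : graph n) : rel 'I_n :=
  fun x y => (x != y) && ([set x; y] \in E).

Definition deg (n : nat) (E : graph n) (x : 'I_n) : nat := #|[set y | adj E x y]|.

(* minimum degree delta(G) (for n = 0 it is 0) *)
Definition mindeg (n : nat) (E : graph n) : nat := \big[minn/n]_(x : 'I_n) deg E x.

Definition indep (n : nat) (E : graph n) (S : {set 'I_n}) : bool :=
  [forall x in S, forall y in S, ~~ adj E x y].

Definition alpha (n : nat) (E : graph n) : nat :=
  \max_(S : {set 'I_n} | indep E S) #|S|.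

Definition del_rel (n : nat) (E : graph n) (S : {set 'I_n}) : rel 'I_n :=
  fun x y => [&& adj E x y, x \notin S & y \notin S].
Definition ncomp (n : nat) (E : graph n) (S : {set 'I_n}) : nat :=
  n_comp (del_rel E S) (~: S).

Definition tough (R : realType) (n : nat) (E : graph n) (t : R) : Prop :=
  forall S : {set 'I_n}, (ncomp E S)%:R <= Num.max 1 ((#|S|)%:R / t).

Definition has_cycle_len (n : nat) (E : graph n) (l : nat) : bool :=
  [exists s : l.-tuple 'I_n, uniq s && cycle (adj E) s].

Definition hamiltonian (n : nat) (E : graph n) : bool :=
  (3 <= n)%N && has_cycle_len E n.

Definition pancyclic (n : nat) (E : graph n) : bool :=
  [forall l : 'I_n.+1, (3 <= l)%N ==> has_cycle_len E l].

(* Probability that G(n,p) union E has property P: R ranges over edge sets of K_n,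
   each edge present independently with probability p. *)
Definition prob_union (R : realType) (n : nat) (E : graph n) (p : R)
    (P : graph n -> bool) : R :=
  \sum_(S : graph n | S \subset pairs n)
     p ^+ #|S| * (1 - p) ^+ (#|pairs n| - #|S|) * (P (E :|: S))%:R.

Local Open Scope classical_set_scope.
Definition aas (R : realType) (u : nat -> R) : Prop := u @ \oo --> (1 : R).

Definition ev (P : nat -> Prop) : Prop := exists N : nat, forall n : nat, (N <= n)%N -> P n.

(* Main.v *)
(** Part (a).  Let [H] be the union of [G] and the random graph.  If deleting
    [A] from [H] leaves [c > |A| / t0] components, then [c <= alpha G], so [A]
    is small compared with [k] and every component of [G - A] has at least
    [k / 2] vertices; grouping the components into two halves gives a set [X],
    a union of [j >= c / 3] components of [G - A], with no random edge from [X]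
    to a linear number of vertices.  A union bound over [A] and the
    representatives of the components in [X] shows that this does not happen,
    so [H] is tough, hence Hamiltonian.  It remains to see that a Hamiltonian
    graph whose minimum degree is at least [1000 alpha] is pancyclic (a theorem
    of Keevash and Sudakov).

    Short cycles: in a breadth first search without a cycle of length [l], the
    layers have at most [(l - 2) alpha] vertices (Erdos, Faudree, Rousseau and
    Schelp), so they soon stop growing, and two consecutive layers span a dense
    subgraph.  There one finds a long chain of triangles, each of which can be
    crossed in one or two steps, and closes it up through the search tree.

    Long cycles: write the Hamilton cycle as [J ++ I] with [|J| = l - 2 alpha - 1].
    If many vertices of [I] have [alpha] neighbours on [J], short-cut [I] and put
    these vertices back one by one.  Otherwise [I] spans a subgraph of large
    minimum degree; it contains a flexible cycle made of triangles, through which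
    the rest of the Hamilton cycle, suitably short-cut, is closed up.

    Parts (b) and (c) are second moment computations: in (b) one of many cliques
    of size [k + 1] receives no random edge, and in (c) more than [|A|] vertices
    have all their neighbours in a set [A]. *)

Require Import Defs.
From HB Require Import structures.
From mathcomp Require Import all_boot all_order all_algebra.
From mathcomp Require Import all_classical all_reals all_analysis.
(* The last three imports restore names shadowed by [all_classical] and [all_algebra]. *)
From mathcomp Require Import zify ring lra fintype finset fingraph.
Import Order.TTheory GRing.Theory Num.Theory.
Set Implicit Arguments. Unset Strict Implicit. Unset Printing Implicit Defensive.

(** * Pancyclicity of Hamiltonian graphs *)

Section Pancyclicity.
Variables (V : finType) (e : rel V) (a : nat).
Hypothesis e_sym : symmetric e.
Hypothesis e_irr : irreflexive e.
Hypothesis indep_bound : forall S : {set V}, a < #|S| ->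
  exists x y, [/\ x \in S, y \in S & e x y].

(* Two of the first [a + 1] vertices of even index are adjacent. *)
Lemma path_shortcut x p : path e x p -> uniq (x :: p) -> 2 * a <= size p ->
  exists p', [/\ path e x p', subseq p' p, last x p' = last x p
               & size p' < size p < size p' + 2 * a].
Proof.
move=> pth uq szp.
pose f (i : 'I_a.+1) := nth x (x :: p) (2 * i).
have f_inj : injective f.
  move=> i j /eqP; have li := ltn_ord i; have lj := ltn_ord j.
  rewrite /f nth_uniq //=; [|lia|lia].
  by move=> /eqP E; apply: val_inj => /=; lia.
have /indep_bound[y [z [/imsetP[i _ ->] /imsetP[j _ ->] eij]]] : a < #|f @: setT|.
  by rewrite card_imset // cardsT card_ord.
have {i j eij} [i [j [eij ltij]]] : exists i j, e (f i) (f j) /\ i < j.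
  case: (ltngtP i j) => [||/val_inj E]; first by exists i, j.
    by exists j, i; rewrite e_sym.
  by rewrite E e_irr in eij.
have lj := ltn_ord j.
have szi : size (take (2 * i) p) = 2 * i by rewrite size_takel; lia.
have lasti : last x (take (2 * i) p) = f i.
  rewrite (last_nth x) szi /f -[x :: take _ _]/(take (2 * i).+1 (x :: p)) nth_take //.
have dropE : drop (2 * j - 1) p = f j :: drop (2 * j) p.
  rewrite (drop_nth x); last lia.
  rewrite /f; have -> : 2 * j = (2 * j - 1).+1 by lia.
  by rewrite /= subn1.
exists (take (2 * i) p ++ drop (2 * j - 1) p); split.
- rewrite cat_path lasti dropE /= eij.
  have := pth; rewrite -{1}(cat_take_drop (2 * i) p) cat_path => /andP[-> _] /=.
  have := pth.
  rewrite -{1}(cat_take_drop (2 * j - 1) p) cat_path dropE /= => /and3P[_ _ ->].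
  by [].
- rewrite -[X in subseq _ X](cat_take_drop (2 * i) p).
  apply: cat_subseq => //.
  have -> : drop (2 * j - 1) p = drop (2 * j - 1 - 2 * i) (drop (2 * i) p).
    by rewrite drop_drop; congr drop; lia.
  exact: drop_subseq.
- rewrite last_cat dropE -[in RHS](cat_take_drop (2 * j - 1) p) last_cat dropE.
  by [].
- rewrite size_cat szi size_drop; lia.
Qed.

(** Each use of [path_shortcut] removes at least one and fewer than [2 * a] vertices, so its
    iteration cannot jump over the window of width [2 * a] below [N]. *)
Lemma path_shorten N x p : path e x p -> uniq (x :: p) -> 2 * a <= N <= size p ->
  exists p', [/\ path e x p', subseq p' p, last x p' = last x p
               & size p' <= N < size p' + 2 * a].
Proof.
move=> + + /andP[aN].
have [m] := ubnP (size p); elim: m p => // m IH p ltm pth uq.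
rewrite leq_eqVlt => /predU1P[EN|ltN].
  (* For [a = 0] a singleton would contain an edge, that is, a loop. *)
  have a0 : 0 < a.
    rewrite lt0n; apply/eqP => a0; have [|y [z [/set1P-> /set1P->]]] := indep_bound (S := [set x]).
      by rewrite cards1 a0.
    by rewrite e_irr.
  by exists p; split => //; lia.
have [|p' [pth' sub' last' /andP[sz1 sz2]]] := path_shortcut pth uq; first lia.
case: (leqP N (size p')) => [leN|ltN'].
  have uq' : uniq (x :: p') by apply: subseq_uniq uq; rewrite /= eqxx.
  have [|p2 [pth2 sub2 last2 sz3]] := IH _ _ pth' uq' leN; first lia.
  by exists p2; split=> //; [exact: subseq_trans sub2 sub'|rewrite last2].
by exists p'; split=> //; lia.
Qed.

Lemma rev_pathE x p q y : path e y (rev (x :: p) ++ q) =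
  [&& e y (last x p), path e x p & path e x q].
Proof.
rewrite lastI rev_rcons /= cat_path rev_path.
rewrite (eq_path (e' := e)) => [|u v]; last exact: e_sym.
by case: p => //= z p; rewrite rev_cons last_rcons.
Qed.

(* As in the Chvatal-Erdos theorem: [w] and the successors on [D] of its
   neighbours cannot be independent. *)
Lemma cycle_insert D w : uniq D -> cycle e D -> w \notin D -> 0 < a ->
  a <= #|[set x in D | e w x]| ->
  exists D', perm_eq D' (w :: D) /\ cycle e D'.
Proof.
move=> uq cyc wD a0 cardN.
set N := [set x in D | e w x] in cardN.
have nxt_inj : injective (next D) := can_inj (prev_next uq).
have wN : w \notin next D @: N.
  apply/imsetP => -[z /setIdP[zD _] E]; move: wD.
  by rewrite E mem_next zD.
have [|x [y [xS yS exy]]] := indep_bound (S := w |: next D @: N).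
  by rewrite cardsU1 wN card_imset.
(* If [w] is adjacent to both [z] and its successor, it fits between them. *)
have case1 z : z \in N -> e w (next D z) ->
    exists D', perm_eq D' (w :: D) /\ cycle e D'.
  case/setIdP=> zD ewz ewn.
  have nD : next D z \in D by rewrite mem_next.
  have [i p E] := rot_to nD.
  exists (w :: next D z :: p); split.
    by rewrite perm_cons -E perm_rot.
  have := cyc; rewrite -(rot_cycle i) E /= rcons_path => /andP[pp _].
  rewrite ewn rcons_path pp /=.
  have := cycle_prev uq; rewrite -(rot_cycle i) E /= rcons_path prev_next //.
  by case/andP=> _ /eqP->; rewrite e_sym ewz.
have [xw|xw] := eqVneq x w.
  move: yS; rewrite !inE => /predU1P[yw|/imsetP[z zN yz]].
    by move: exy; rewrite xw yw e_irr.
  by apply: (case1 z) => //; rewrite -yz -xw.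
have [yw|yw] := eqVneq y w.
  move: xS; rewrite !inE (negPf xw) /= => /imsetP[z zN xz].
  by apply: (case1 z) => //; rewrite -xz -yw e_sym.
move: xS yS; rewrite !inE (negPf xw) (negPf yw) /=.
move=> /imsetP[z /setIdP[zD ewz] xz] /imsetP[z' /setIdP[z'D ewz'] yz].
have xy : x != y by apply: contraTneq exy => ->; rewrite e_irr.
have xD : x \in D by rewrite xz mem_next.
have yD : y \in D by rewrite yz mem_next.
have [i p1 p2 _ _ E] := rot_to_arc uq xD yD xy.
have px : prev D x = z by rewrite xz prev_next.
have py : prev D y = z' by rewrite yz prev_next.
have := cycle_prev uq; rewrite -(rot_cycle i) E /= rcons_cat cat_path /= rcons_path.
rewrite px py => /and4P[_ /eqP lastx _ /eqP lasty].
(* The new cycle runs from [w] to [z'], backwards along the arc to [x], over the edge to [y], and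
   forwards to [z], which is adjacent to [w]. *)
exists (w :: rev (x :: p1) ++ y :: p2); split.
  by rewrite perm_cons perm_sym -(perm_rot i) E -cat_cons perm_cat2r perm_sym perm_rev.
have := cyc; rewrite -(rot_cycle i) E /= rcons_cat cat_path /= rcons_path.
move=> /and4P[pth1 _ pth2 _].
by rewrite rcons_cat rev_pathE lastx ewz' pth1 /= exy rcons_path pth2 lasty e_sym ewz.
Qed.

Lemma cycle_insert_set D (T : {set V}) j : uniq D -> cycle e D -> 0 < a ->
  {in T, forall t, t \notin D /\ a <= #|[set x in D | e t x]|} -> j <= #|T| ->
  exists D', [/\ uniq D', cycle e D' & size D' = size D + j].
Proof.
move=> + + a0; elim: j D T => [|j IH] D T uq cyc HT ltj.
  by exists D; rewrite addn0.
have [t tT] : exists t, t \in T by apply/card_gt0P; lia.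
have [tD tN] := HT t tT.
have [D1 [pD1 cyc1]] := cycle_insert uq cyc tD a0 tN.
have [|x xT||D' [uq' cyc' sz']] := IH D1 (T :\ t) _ cyc1.
- by rewrite (perm_uniq pD1) /= tD uq.
- move: xT; rewrite in_setD1 => /andP[xt xT]; have [xD xN] := HT x xT.
  rewrite (perm_mem pD1) inE (negPf xt); split=> //.
  apply: leq_trans xN _; apply/subset_leq_card/subsetP => y.
  by rewrite !inE (perm_mem pD1) inE => /andP[-> ->]; rewrite orbT.
- by move: ltj; rewrite (cardsD1 t T) tT.
by exists D'; split=> //; rewrite sz' (perm_size pD1) /=; lia.
Qed.

(** * Chains of triangles *)

(* The tips of a sequence are vertices that can be skipped independently of each other. *)
Fixpoint tip_ok (Tp : pred V) (s : seq V) : bool :=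
  if s is x :: s1 then
    (if s1 is t :: y :: _ then Tp t ==> [&& ~~ Tp x, ~~ Tp y & e x y] else true)
    && tip_ok Tp s1
  else true.

Lemma tip_ok_catl Tp s1 s2 : tip_ok Tp (s1 ++ s2) -> tip_ok Tp s1.
Proof.
elim: s1 => //= x s1 IH /andP[H /IH ->]; rewrite andbT.
by case: s1 H {IH} => //= t [|y s1].
Qed.

Lemma tip_ok_catr Tp s1 s2 : tip_ok Tp (s1 ++ s2) -> tip_ok Tp s2.
Proof. by elim: s1 => //= x s1 IH /andP[_ /IH]. Qed.

Lemma tip_ok_glue Tp s1 x s2 : tip_ok Tp (rcons s1 x) -> tip_ok Tp (x :: s2) ->
  ~~ Tp x -> tip_ok Tp (s1 ++ x :: s2).
Proof.
move=> + ok2 nx; elim: s1 => //= y s1 IH /andP[H /IH ->]; rewrite andbT.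
case: s1 H {IH} => [|t [|z s1]] //=.
by case: s2 ok2 => //= *; rewrite (negPf nx).
Qed.

Lemma tip_ok_cons Tp x y s : ~~ Tp y -> tip_ok Tp (y :: s) -> tip_ok Tp (x :: y :: s).
Proof. by move=> ny oks; case: s oks => //= z s ->; rewrite (negPf ny). Qed.

Lemma eq_in_tip_ok (T1 T2 : pred V) s : {in s, T1 =1 T2} -> tip_ok T1 s = tip_ok T2 s.
Proof.
elim: s => //= x s IH eqT; rewrite IH => [|y ys]; last by apply: eqT; rewrite inE ys orbT.
case: s eqT {IH} => //= t [|y s] // eqT.
by rewrite !eqT // !inE eqxx ?orbT.
Qed.

(** No two tips are consecutive, so skipping one leaves the others removable. *)
Lemma tip_remove Tp j x p y : path e x (rcons p y) -> tip_ok Tp (x :: rcons p y) ->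
  j <= count Tp p ->
  exists p', [/\ path e x (rcons p' y), subseq p' p & size p' + j = size p].
Proof.
elim: p x j => [|t p IH] x j pth ok lej.
  by exists [::]; split=> //; move: lej => /=; lia.
case: j lej => [|j] lej; first by exists (t :: p); rewrite addn0; split.
move: pth => /= /andP[ext pth].
have ok2 : tip_ok Tp (t :: rcons p y) by move: ok => /andP[].
have [tT|tT] := boolP (Tp t).
  have [z [q Eq]] : exists z q, rcons p y = z :: q.
    by case: (p) => [|z q]; [exists y, [::]|exists z, (rcons q y)].
  move: ok; rewrite /= Eq tT /= => /andP[/and3P[nx nz exz] _].
  have [|||p' [pth' sub' sz']] := IH x j.
  - by rewrite Eq /= exz; move: pth; rewrite Eq /= => /andP[].
  - by rewrite Eq; apply: tip_ok_cons => //; move: ok2; rewrite Eq => /andP[].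
  - by move: lej => /=; rewrite tT.
  exists p'; split=> //; last by move=> /=; lia.
  exact: subseq_trans sub' (subseq_cons _ _).
have [|p' [pth' sub' sz']] := IH t j.+1 pth ok2.
  by move: lej => /=; rewrite (negPf tT).
exists (t :: p'); split=> //=; [by rewrite ext|by rewrite eqxx|lia].
Qed.

Lemma triangle_chain (P Q : {set V}) d m x :
  {in P, forall y, d <= #|[set z in Q | e y z]|} ->
  {in Q, forall y, d <= #|[set z in P | e y z]|} ->
  x \in P -> 2 * m + a <= d ->
  exists p (T : {set V}), [/\ path e x p, uniq (x :: p), size p = 2 * m,
    {subset x :: p <= P :|: Q} & last x p \in if odd m then Q else P]
   /\ [/\ tip_ok (mem T) (x :: p), x \notin T, last x p \notin T,
       {subset T <= x :: p} & count (mem T) (x :: p) = m].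
Proof.
move=> degP degQ xP; elim: m => [|m IH] lem.
  exists [::], set0; rewrite /= !inE !xP; split; split=> //.
  - by move=> y; rewrite !inE => /eqP->; rewrite xP.
  - by move=> y; rewrite inE.
have [|p [T [[pth uq sz sub lastP] [ok xT lT subT cnt]]]] := IH; first lia.
set l := last x p in lastP lT *.
pose S := if odd m then P else Q.
have degl : d <= #|[set z in S | e l z]|.
  by rewrite /S; move: lastP; case: (odd m); [exact: degQ|exact: degP].
have /indep_bound[v [w [vS wS evw]]] : a < #|[set z in S | e l z] :\: [set z in x :: p]|.
  have szs : #|[set z in x :: p]| <= 2 * m + 1.
    by rewrite cardsE (leq_trans (card_size _)) //= sz; lia.
  by have := cardsD [set z in S | e l z] [set z in x :: p];
     have := subset_leq_card (subsetIr [set z in S | e l z] [set z in x :: p]); lia.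
move: vS wS; rewrite 2!in_setD 2!inE => /andP[vp /andP[vS elv]].
rewrite 2!inE inE => /andP[wp /andP[wS elw]].
have vw : v != w by apply: contraTneq evw => ->; rewrite e_irr.
have TE : {in x :: p, mem (v |: T) =1 mem T}.
  by move=> y yp; rewrite !inE; case: eqP => // yv; move: vp; rewrite -yv yp.
have nv : v \notin T by apply: contra vp => /subT.
exists (p ++ [:: v; w]), (v |: T); split; split.
- by rewrite cat_path pth /= elv evw.
- rewrite -cat_cons cat_uniq uq /= !inE vw orbF negb_or; move: vp wp; rewrite !inE => -> ->.
  by [].
- by rewrite size_cat sz mulnS addnC.
- move=> y; rewrite -cat_cons mem_cat => /orP[/sub//|].
  rewrite !inE => /orP[]/eqP->; move: vS wS; rewrite /S; case: (odd m) => vS wS;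
  by rewrite ?vS ?wS ?orbT.
- by rewrite last_cat /=; move: wS; rewrite /S /=; case: (odd m).
- rewrite -cat_cons (lastI x p) cat_rcons; apply: tip_ok_glue.
  + by rewrite -lastI (eq_in_tip_ok TE).
  + have lnv : last x p != v by apply: contraNneq vp => <-; rewrite mem_last.
    by rewrite /= !inE eqxx /= (negPf lnv) (negPf lT) eq_sym (negPf vw) elw /= andbT
      (contra _ wp) // => /subT.
  + by rewrite /= !inE negb_or lT andbT; apply: contraNneq vp => <-; rewrite mem_last.
- rewrite !inE negb_or xT andbT; apply: contraNneq vp => <-; exact: mem_head.
- by rewrite last_cat /= !inE negb_or eq_sym vw /= (contra _ wp) // => /subT.
- move=> y; rewrite -cat_cons mem_cat !inE => /predU1P[->|/subT]; first by rewrite eqxx orbT.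
  by rewrite inE => ->.
- rewrite -cat_cons count_cat (eq_in_count TE) cnt /= !inE eqxx eq_sym (negPf vw) /=.
  have -> : w \in T = false by apply/negbTE; apply: contra wp => /subT.
  by rewrite addn1.
Qed.

(** * Dense cores and monotone paths *)

Lemma sum_deg_sym (X Y : {set V}) :
  \sum_(x in X) #|[set y in Y | e x y]| = \sum_(y in Y) #|[set x in X | e y x]|.
Proof.
have E (A B : {set V}) : \sum_(x in A) #|[set y in B | e x y]| =
    \sum_(x in A) \sum_(y in B) e x y.
  apply: eq_bigr => x _; rewrite cardsE -sum1_card big_mkcondr /=.
  by apply: eq_bigr => y _; case: (e x y).
rewrite !E exchange_big /=; apply: eq_bigr => y _; apply: eq_bigr => x _.
by rewrite e_sym.
Qed.

(** Peel off vertices with fewer than [d] neighbours on the other side. Each deletion destroys fewer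
    than [d] of the counted edges, so the strict density inequality survives and the core is not
    empty. *)
Lemma dense_core (X Y : {set V}) d :
  d * (#|X| + #|Y|) < \sum_(x in X) #|[set y in Y | e x y]| ->
  exists P Q : {set V}, [/\ P \subset X, Q \subset Y, P != set0,
    {in P, forall y, d <= #|[set z in Q | e y z]|} &
    {in Q, forall y, d <= #|[set z in P | e y z]|}].
Proof.
have [m] := ubnP (#|X| + #|Y|); elim: m X Y => // m IH X Y ltm dense.
have [/existsP[x /andP[xX ltd]]|] :=
  boolP [exists x, (x \in X) && (#|[set y in Y | e x y]| < d)].
  have cX := cardsD1 x X; rewrite xX in cX.
  have [||P [Q [PX QY P0 dP dQ]]] := IH (X :\ x) Y; first lia.
    move: dense; rewrite (big_setD1 x) //= cX; nia.
  by exists P, Q; split=> //; exact: subset_trans PX (subsetDl _ _).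
rewrite negb_exists => /forallP dX.
have [/existsP[y /andP[yY ltd]]|] :=
  boolP [exists y, (y \in Y) && (#|[set x in X | e y x]| < d)].
  have cY := cardsD1 y Y; rewrite yY in cY.
  have [||P [Q [PX QY P0 dP dQ]]] := IH X (Y :\ y); first lia.
    rewrite sum_deg_sym; move: dense; rewrite sum_deg_sym (big_setD1 y) //= cY; nia.
  by exists P, Q; split=> //; exact: subset_trans QY (subsetDl _ _).
rewrite negb_exists => /forallP dY.
exists X, Y; split=> //.
- by apply: contraTneq dense => ->; rewrite big_set0.
- by move=> x xX; have := dX x; rewrite xX /= -leqNgt.
- by move=> y yY; have := dY y; rewrite yY /= -leqNgt.
Qed.

(** The vertices of [S] without a neighbour of smaller weight in [S] are independent, hence at most
    [a]. A path found among the other vertices can be extended at its start by a smaller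
    neighbour. *)
Lemma increasing_path (w : V -> nat) (S : {set V}) q : {in S &, injective w} ->
  q * a < #|S| ->
  exists x p, [/\ path e x p, path (relpre w ltn) x p, {subset x :: p <= S} & size p = q].
Proof.
elim: q S => [|q IH] S w_inj ltS.
  have [x xS] : exists x, x \in S by apply/card_gt0P.
  by exists x, [::]; split=> // y; rewrite inE => /eqP->.
pose S' := [set y in S | [exists x in S, e x y && (w x < w y)]].
have leS : #|S :\: S'| <= a.
  rewrite leqNgt; apply/negP => /indep_bound[x [y [/setDP[xS nx] /setDP[yS ny] exy]]].
  case: (ltngtP (w x) (w y)) => [lt|lt|/w_inj E].
  - by case/negP: ny; rewrite inE yS; apply/existsP; exists x; rewrite xS exy lt.
  - by case/negP: nx; rewrite inE xS; apply/existsP; exists y; rewrite yS e_sym exy lt.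
  - by move: exy; rewrite E // e_irr.
have subS' : S' \subset S by apply/subsetP => y /setIdP[].
have := cardsD S S'; rewrite (setIidPr subS') => cS.
have [||x [p [pth inc sub sz]]] := IH S'.
- by move=> y z /(subsetP subS') yS /(subsetP subS') zS; exact: w_inj.
- by have := subset_leq_card subS'; lia.
have /setIdP[_ /existsP[u /and3P[uS eux wux]]] : x \in S' by apply: sub; rewrite mem_head.
exists u, (x :: p); split=> /=; [by rewrite eux|by rewrite wux| |by rewrite sz].
by move=> y; rewrite inE => /predU1P[->//|/sub/(subsetP subS')].
Qed.

(** * Breadth first search inside a vertex set *)

Section Layers.
Variables (Z : {set V}) (v : V).
Hypothesis vZ : v \in Z.

Fixpoint dist_ball i : {set V} :=
  if i is j.+1 then dist_ball j :|: [set y in Z | [exists x in dist_ball j, e x y]] else [set v].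

Definition layer i : {set V} := if i is j.+1 then dist_ball j.+1 :\: dist_ball j else [set v].

Lemma ball_mono i j : i <= j -> dist_ball i \subset dist_ball j.
Proof.
elim: j => [|j IH]; first by rewrite leqn0 => /eqP->.
rewrite leq_eqVlt => /predU1P[->//|/IH/subset_trans]; apply.
exact: subsetUl.
Qed.

Lemma ball_sub i : dist_ball i \subset Z.
Proof.
elim: i => [|i IH] /=; first by rewrite sub1set.
by rewrite subUset IH; apply/subsetP => y; rewrite inE => /andP[].
Qed.

Lemma layer_dist_ball i : layer i \subset dist_ball i.
Proof. by case: i => //= i; exact: subsetDl. Qed.

Lemma layer_sub i : layer i \subset Z.
Proof. exact: subset_trans (layer_dist_ball i) (ball_sub i). Qed.

Lemma layer_notin_ball i j y : j < i -> y \in layer i -> y \notin dist_ball j.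
Proof.
case: i => // i; rewrite ltnS => /ball_mono/subsetP sub /setDP[_].
exact/contra/sub.
Qed.

Lemma layer_inj i j y : y \in layer i -> y \in layer j -> i = j.
Proof.
move=> yi yj; case: (ltngtP i j) => // lt.
- by have := layer_notin_ball lt yj; rewrite (subsetP (layer_dist_ball i)).
- by have := layer_notin_ball lt yi; rewrite (subsetP (layer_dist_ball j)).
Qed.

Lemma ball_step i x y : x \in dist_ball i -> y \in Z -> e x y -> y \in dist_ball i.+1.
Proof.
by move=> xb yZ exy; rewrite /= !inE yZ /= orbC; apply/orP; left; apply/existsP; exists x; rewrite xb.
Qed.

Lemma layer_nonadj i j x y : i.+1 < j -> x \in layer i -> y \in layer j -> ~~ e x y.
Proof.
move=> lt xi yj; apply/negP => exy.
have := layer_notin_ball lt yj.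
by rewrite (ball_step (subsetP (layer_dist_ball i) _ xi) _ exy) // (subsetP (layer_sub j)).
Qed.

Lemma ball_layer i y : y \in dist_ball i -> exists2 j, j <= i & y \in layer j.
Proof.
elim: i => [|i IH] yb; first by exists 0.
have [/IH[j lej yj]|nyb] := boolP (y \in dist_ball i); first by exists j => //; exact: leqW.
by exists i.+1 => //; rewrite inE nyb yb.
Qed.

Lemma layer_adj i x y : x \in layer i -> y \in Z -> e x y ->
  y \in layer i.-1 :|: layer i :|: layer i.+1.
Proof.
move=> xi yZ exy.
have [j lej yj] := ball_layer (ball_step (subsetP (layer_dist_ball i) _ xi) yZ exy).
have lej' : i <= j.+1.
  by rewrite leqNgt; apply/negP => lt; have := layer_nonadj lt yj xi; rewrite e_sym exy.
rewrite !in_setU; move: yj.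
by have [->|[->|->]] : j = i.-1 \/ j = i \/ j = i.+1 by [lia]; move=> ->; rewrite ?orbT.
Qed.

(** Fixes a search tree; the default [y] is never returned for [y] in [layer i.+1]. *)
Definition parent i y := odflt y [pick x in layer i | e x y].

Lemma parentP i y : y \in layer i.+1 -> parent i y \in layer i /\ e (parent i y) y.
Proof.
move=> yi; rewrite /parent; case: pickP => [x /andP[-> ->]//|none].
move: (yi) => /setDP[]; rewrite /= !inE => /orP[->//|/andP[yZ /existsP[x /andP[xb exy]]]] nyb.
have [j lej xj] := ball_layer xb.
have Ej : j = i.
  apply/eqP; rewrite eqn_leq lej leqNgt; apply/negP => lt.
  by have := layer_nonadj (lt : j.+1 < i.+1) xj yi; rewrite exy.
by have := none x; rewrite exy -Ej xj.
Qed.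

Fixpoint ancestor i h y := if h is h'.+1 then parent (i - h) (ancestor i h' y) else y.

Lemma ancestor_layer i h y : y \in layer i -> h <= i -> ancestor i h y \in layer (i - h).
Proof.
move=> yi; elim: h => [|h IH] leh; first by rewrite subn0.
have [] // := @parentP (i - h.+1) (ancestor i h y).
by rewrite -subSn // subSS; apply: IH; exact: ltnW.
Qed.

Lemma ancestor_adj i h y : y \in layer i -> h < i ->
  e (ancestor i h y) (ancestor i h.+1 y).
Proof.
move=> yi lth; rewrite e_sym.
have [] // := @parentP (i - h.+1) (ancestor i h y).
by rewrite -subSn // subSS; apply: ancestor_layer => //; exact: ltnW.
Qed.

(** Otherwise the ancestors of [y] at heights 0, 2, ..., [2 * a] would be [a + 1] independent
    vertices, because their layers are at least two apart. *)
Lemma layer_bound i y : 0 < a -> y \in layer i -> i < 2 * a.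
Proof.
move=> a0 yi; rewrite ltnNge; apply/negP => lei.
pose f (t : 'I_a.+1) := ancestor i (2 * t) y.
have fl (t : 'I_a.+1) : f t \in layer (i - 2 * t).
  by apply: ancestor_layer => //; have := ltn_ord t; lia.
have f_inj : injective f.
  move=> s t E; have := fl s; rewrite E => /layer_inj/(_ (fl t)) E'.
  by apply: val_inj => /=; have := ltn_ord s; have := ltn_ord t; lia.
have /indep_bound[x [z [/imsetP[s _ ->] /imsetP[t _ ->] est]]] : a < #|f @: setT|.
  by rewrite card_imset // cardsT card_ord.
have ls := ltn_ord s; have lt := ltn_ord t.
have [E|nst] := eqVneq s t; first by rewrite E e_irr in est.
have {}nst : (s : nat) != t by [].
have [lst|lst] := ltnP s t.
  have := @layer_nonadj (i - 2 * t) (i - 2 * s) _ _ _ (fl t) (fl s).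
  by rewrite e_sym est => H; apply/notF/H; lia.
have := @layer_nonadj (i - 2 * s) (i - 2 * t) _ _ _ (fl s) (fl t).
by rewrite est => H; apply/notF/H; move/eqP: nst; lia.
Qed.

Lemma ancestor_path i s k y : y \in layer i -> s + k <= i ->
  path e (ancestor i s y) [seq ancestor i t y | t <- iota s.+1 k].
Proof.
move=> yi; elim: k s => //= k IH s lek.
by rewrite -[parent _ _]/(ancestor i s.+1 y) ancestor_adj ?IH //; lia.
Qed.

Lemma ancestor_eq_le i h h' y y' : h <= h' ->
  ancestor i h y = ancestor i h y' -> ancestor i h' y = ancestor i h' y'.
Proof. by move=> /subnKC <- E; elim: (h' - h) => [|k IH]; rewrite ?addn0 // addnS /= IH. Qed.

Lemma ancestor_root i y : y \in layer i -> ancestor i i y = v.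
Proof. by move=> yi; have := ancestor_layer yi (leqnn i); rewrite subnn => /set1P. Qed.

Lemma common_ancestor i y y' : y \in layer i -> y' \in layer i -> y != y' ->
  exists2 h, h < i & ancestor i h y != ancestor i h y' /\
    ancestor i h.+1 y = ancestor i h.+1 y'.
Proof.
move=> yi yi' ny.
have ex : exists h, ancestor i h y == ancestor i h y'.
  by exists i; rewrite !ancestor_root.
case: (ex_minnP ex) => -[|h] /eqP E hmin; first by rewrite [y]E eqxx in ny.
exists h; last by split=> //; apply/negP => /hmin; rewrite ltnn.
by apply: hmin; rewrite !ancestor_root.
Qed.

(** The path climbs from [y'] to the common ancestor ([h + 1] vertices) and descends to [y] ([h]
    vertices). The branches are disjoint below that ancestor, since ancestors that agree at one
    height agree at all larger ones. *)
Lemma tree_closing i h y y' : y \in layer i -> y' \in layer i -> h < i ->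
  ancestor i h y != ancestor i h y' -> ancestor i h.+1 y = ancestor i h.+1 y' ->
  exists r, [/\ path e y' (rcons r y), uniq r, size r = h.*2.+1 &
    {in r, forall z, exists2 t, t < i & z \in layer t}].
Proof.
move=> yi yi' lth nE E.
pose up := [seq ancestor i t y' | t <- iota 1 h.+1].
pose dn := [seq ancestor i t y | t <- iota 1 h].
have dnP z : z \in dn -> exists2 t, 0 < t <= h & z = ancestor i t y.
  by case/mapP=> t; rewrite mem_iota add1n ltnS => Ht ->; exists t.
have upP z : z \in up -> exists2 t, 0 < t <= h.+1 & z = ancestor i t y'.
  by case/mapP=> t; rewrite mem_iota add1n ltnS => Ht ->; exists t.
have map_uniq u k : k <= i -> u \in layer i -> uniq [seq ancestor i t u | t <- iota 1 k].
  move=> lek ui; rewrite map_inj_in_uniq ?iota_uniq // => s t.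
  rewrite !mem_iota => Hs Ht Est.
  have lu : ancestor i s u \in layer (i - s) by apply: ancestor_layer => //; lia.
  have lu' : ancestor i t u \in layer (i - t) by apply: ancestor_layer => //; lia.
  by rewrite Est in lu; have := layer_inj lu lu'; lia.
exists (up ++ rev dn); split.
- rewrite rcons_cat cat_path -rev_cons.
  have := @ancestor_path i 0 h.+1 y' yi'; rewrite add0n => ->//=.
  have -> : last (ancestor i 1 y') [seq ancestor i t y' | t <- iota 2 h] = ancestor i h.+1 y.
    rewrite E -[iota 2 h]/(behead (iota 1 h.+1)) (last_nth v).
    rewrite -[ancestor i 1 y' :: _]/(up) (nth_map 0) size_map size_behead size_iota //.
    by rewrite nth_iota ?add1n.
  rewrite -[rev _]cats0 rev_pathE; apply/and3P; split=> //.
    have -> : last y dn = ancestor i h y.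
      rewrite (last_map (fun t => ancestor i t y) _ 0); congr ancestor.
      by case: (h) => // k; rewrite -[k.+1]addn1 iotaD last_cat /= addnC.
    by rewrite e_sym; apply: ancestor_adj.
  by apply: (@ancestor_path i 0 h y); lia.
- rewrite cat_uniq rev_uniq !map_uniq ?andbT //; last lia.
  apply/hasPn => z; rewrite mem_rev => /dnP[t Ht ->]; apply/negP => /upP[t' Ht' Et].
  have lu : ancestor i t y \in layer (i - t) by apply: ancestor_layer => //; lia.
  have lu' : ancestor i t' y' \in layer (i - t') by apply: ancestor_layer => //; lia.
  have Ett : t = t' by rewrite Et in lu; have := layer_inj lu lu'; lia.
  case/negP: nE; apply/eqP; apply: (@ancestor_eq_le i t) => //; last by rewrite {2}Ett.
  by case/andP: Ht.
- by rewrite size_cat size_rev !size_map !size_iota; lia.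
move=> z; rewrite mem_cat mem_rev => /orP[/upP|/dnP] [t Ht ->]; exists (i - t); try lia;
  by apply: ancestor_layer => //; lia.
Qed.

(* The base [#|V|] digits of [code i y] are the ranks of the ancestors of [y], so that
   dividing by [#|V| ^ h] yields the code of the [h]-th ancestor; the order of the codes
   is thus compatible with the search tree. *)
Fixpoint code i y : nat :=
  if i is i'.+1 then code i' (parent i' y) * #|V| + enum_rank y else 0.

Lemma code_ancestor i h y : h <= i ->
  code (i - h) (ancestor i h y) = code i y %/ #|V| ^ h.
Proof.
elim: h => [|h IH] leh; first by rewrite subn0 divn1.
have V0 : 0 < #|V| by apply/card_gt0P; exists y.
rewrite expnSr divnMA -IH; last exact: ltnW.
have -> : i - h = (i - h.+1).+1 by lia.
by rewrite /= divnMDl // divn_small // addn0.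
Qed.

Lemma code_inj i : {in layer i &, injective (code i)}.
Proof.
case: i => [|i] y z; first by move=> /set1P-> /set1P->.
move=> _ _ /= E; apply/enum_rank_inj/val_inj => /=.
have := congr1 (modn^~ #|V|) E.
by rewrite !modnMDl !modn_small.
Qed.

(* A path of [l - 1] vertices of layer [i] with increasing codes has a window of
   [l - 1 - 2 h] vertices whose ends have their first common ancestor exactly [h + 1]
   levels up; climbing to it from both ends closes a cycle of length [l]. *)
Lemma layer_cycle l i : (l - 2) * a < #|layer i| -> 0 < i -> 2 * i < l ->
  exists s, [/\ uniq s, cycle e s & size s = l].
Proof.
move=> big i0 il.
have [x [p [pth inc sub sz]]] := increasing_path (@code_inj i) big.
pose y t := nth v (x :: p) t.
have ylay t : t <= l - 2 -> y t \in layer i.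
  by move=> lt; apply/sub/mem_nth; rewrite /= sz ltnS.
have uq : uniq (x :: p).
  rewrite -(map_inj_in_uniq (f := code i)); last first.
    by move=> u u' /sub ui /sub ui'; exact: code_inj.
  apply: (sorted_uniq ltn_trans ltnn); rewrite sorted_map; exact: inc.
have mono h s t : s <= t <= l - 2 -> h <= i ->
    code (i - h) (ancestor i h (y s)) <= code (i - h) (ancestor i h (y t)).
  move=> /andP[lest let_] leh; rewrite !code_ancestor // leq_div2r //.
  move: lest; rewrite leq_eqVlt => /predU1P[->//|ltst].
  have tr : transitive (relpre (code i) ltn) by move=> ? ? ?; exact: ltn_trans.
  apply/ltnW; apply: (sorted_ltn_nth tr v (s := x :: p) inc) => //; rewrite inE /= sz; lia.
have cinj h s t : s <= l - 2 -> t <= l - 2 -> h <= i ->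
    code (i - h) (ancestor i h (y s)) = code (i - h) (ancestor i h (y t)) ->
    ancestor i h (y s) = ancestor i h (y t).
  by move=> ls lt lh; apply: code_inj; apply: ancestor_layer => //; exact: ylay.
have [|||h lth [nE E]] := @common_ancestor i (y 0) (y (l - 2)).
- exact: ylay.
- exact: ylay.
- by rewrite nth_uniq //= ?sz; lia.
pose dl := l - 2 - 2 * h.
(* If the ancestors at height [h] agreed at both ends of every window, monotonicity would make them
   constant on the indices up to [2 * h]; the last window ends at [l - 2], so [y 0] and [y (l - 2)]
   would agree as well. *)
have [t let_ nEt] : exists2 t, t <= 2 * h &
    ancestor i h (y t) != ancestor i h (y (t + dl)).
  have [/existsP[t nEt]|] :=
    boolP [exists t : 'I_(2 * h).+1, ancestor i h (y t) != ancestor i h (y (t + dl))].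
    by exists t => //; rewrite -ltnS.
  rewrite negb_exists => /forallP allE.
  have {}allE t : t <= 2 * h -> ancestor i h (y t) = ancestor i h (y (t + dl)).
    by rewrite -ltnS => lt; have := allE (Ordinal lt) => /negPn/eqP.
  have step t : t <= 2 * h -> code (i - h) (ancestor i h (y t)) = code (i - h) (ancestor i h (y 0)).
    elim: t => // t IH lt; rewrite -IH; last exact: ltnW.
    have := mono h t t.+1; have := mono h t.+1 (t + dl).
    by rewrite -allE ?(ltnW lt) // /dl => H1 H2; apply/eqP; rewrite eqn_leq H1 ?H2 //; lia.
  case/negP: nE; apply/eqP; apply: cinj; rewrite ?(ltnW lth) //.
  rewrite -(step (2 * h)) // allE //; congr (code _ (ancestor _ _ (y _))); rewrite /dl; lia.
(* One level higher the codes of [y 0] and [y (l - 2)] are equal, and all codes in between are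
   squeezed. *)
have Et : ancestor i h.+1 (y t) = ancestor i h.+1 (y (t + dl)).
  apply: cinj => //; rewrite ?/dl; try lia.
  have := mono h.+1 0 t; have := mono h.+1 t (t + dl); have := mono h.+1 (t + dl) (l - 2).
  by rewrite E /dl; lia.
have [||r [pr ur szr inr]] := tree_closing _ _ lth nEt Et.
- by apply: ylay; lia.
- by apply: ylay; rewrite /dl; lia.
have szd : size (take dl (drop t p)) = dl by rewrite size_takel // size_drop sz /dl; lia.
have wE : take dl.+1 (drop t (x :: p)) = y t :: take dl (drop t p).
  by rewrite (drop_nth v) //= sz; lia.
have lastw : last (y t) (take dl (drop t p)) = y (t + dl).
  rewrite (last_nth v) szd -wE nth_take // nth_drop //.
exists ((y t :: take dl (drop t p)) ++ r); split.
- rewrite cat_uniq ur andbT -wE take_uniq ?drop_uniq //=.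
  apply/hasPn => z /inr[j ltj zj]; apply/negP => /mem_take/mem_drop/sub zi.
  by move: ltj; rewrite (layer_inj zi zj) ltnn.
- rewrite /= rcons_cat cat_path lastw pr andbT.
  have : sorted e (take dl.+1 (drop t (x :: p))) by apply/take_sorted/drop_sorted.
  by rewrite wE.
- by rewrite size_cat /= szd szr /dl; lia.
Qed.

End Layers.

(** * Flexible cycles *)

(* [i] is the first layer such that the next one is at most four times larger. *)
Lemma layer_core (Z : {set V}) v d d0 : v \in Z ->
  {in Z, forall z, d <= #|[set y in Z | e z y]|} -> 15 * d0 < d ->
  exists i (P Q : {set V}),
   [/\ P \subset layer Z v i, Q \subset layer Z v i :|: layer Z v i.+1, P != set0,
      {in P, forall y, d0 <= #|[set z in Q | e y z]|} &
      {in Q, forall y, d0 <= #|[set z in P | e y z]|}]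
   /\ forall t, t < i -> 4 * #|layer Z v t| < #|layer Z v t.+1|.
Proof.
move=> vZ degZ ltd; set L := layer Z v.
have ex : exists i, #|L i.+1| <= 4 * #|L i|.
  have [/existsP[i Hi]|] := boolP [exists i : 'I_#|V|.+1, #|L i.+1| <= 4 * #|L i|].
    by exists i.
  rewrite negb_exists => /forallP none.
  suff H t : t <= #|V| -> t < #|L t| by have := H _ (leqnn #|V|); rewrite ltnNge max_card.
  elim: t => [|t IH] lt; first by rewrite /L /= cards1.
  by have := none (Ordinal (leqW lt)); have := IH (ltnW lt); rewrite -ltnNge /=; lia.
case: (ex_minnP ex) => i gi gmin.
have grow t : t < i -> 4 * #|L t| < #|L t.+1|.
  by move=> lt; rewrite ltnNge; apply/negP => /gmin; lia.
have prev5 : #|L i.-1| + #|L i| <= 5 * #|L i|.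
  by case: (i) grow => [|i'] /= grow; [|have := grow i' (ltnSn _)]; lia.
have Li0 : 0 < #|L i|.
  by case: (i) grow => [|i'] grow; [rewrite /L /= cards1|have := grow i' (ltnSn _); lia].
have sumd : d * #|L i| <= \sum_(x in L i) #|[set y in L i.-1 | e x y]|
    + \sum_(x in L i) #|[set y in L i | e x y]| + \sum_(x in L i) #|[set y in L i.+1 | e x y]|.
  rewrite -!big_split /= mulnC -sum_nat_const; apply: leq_sum => x xi.
  have xZ := subsetP (layer_sub vZ i) _ xi.
  apply: leq_trans (degZ x xZ) _.
  apply: leq_trans (leq_add (leq_card_setU _ _).1 (leqnn _)).
  apply: leq_trans (leq_card_setU _ _).1; apply/subset_leq_card/subsetP => y.
  rewrite inE => /andP[yZ exy]; have := layer_adj vZ xi yZ exy.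
  by rewrite !in_setU !inE exy !andbT.
(* If none of the three edge counts passed its threshold, they would add up to at most
   [12 * d0 * #|L i|], less than [d * #|L i|]. In this first case the sum is turned around, so that
   [P] lies in the lower layer [i.-1]. *)
have [dn|dn] := ltnP (d0 * (#|L i.-1| + #|L i|)) (\sum_(x in L i) #|[set y in L i.-1 | e x y]|).
  rewrite sum_deg_sym in dn; have [P [Q [PX QY P0 dP dQ]]] := dense_core dn.
  exists i.-1, P, Q; split; last by move=> t lt; apply: grow; lia.
  split=> //; apply: subset_trans QY _; case: (i) => [|i'] /=; first exact: subsetUl.
  exact: subsetUr.
have [dn0|dn0] := ltnP (d0 * (#|L i| + #|L i|)) (\sum_(x in L i) #|[set y in L i | e x y]|).
  have [P [Q [PX QY P0 dP dQ]]] := dense_core dn0.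
  exists i, P, Q; split=> //; split=> //; apply: subset_trans QY (subsetUl _ _).
have [dn1|dn1] := ltnP (d0 * (#|L i| + #|L i.+1|)) (\sum_(x in L i) #|[set y in L i.+1 | e x y]|).
  have [P [Q [PX QY P0 dP dQ]]] := dense_core dn1.
  exists i, P, Q; split=> //; split=> //; apply: subset_trans QY (subsetUr _ _).
exfalso; move: sumd dn dn0 dn1 gi prev5 Li0 ltd; clear; nia.
Qed.

Lemma tip_ok_none (Tp : pred V) s : all (predC Tp) s -> tip_ok Tp s.
Proof.
elim: s => //= x s IH /andP[_ als]; rewrite IH // andbT.
by case: s als {IH} => //= t [|y s] //= /andP[/negPf->].
Qed.

(** A chain of [m] triangles in the core is closed up through the search tree. As [m] is even, the
    chain ends in [P], in the same layer as it starts; the closing path stays in lower layers and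
    therefore avoids the chain. *)
Lemma flexible_cycle (Z : {set V}) v d d0 m : v \in Z ->
  {in Z, forall z, d <= #|[set y in Z | e z y]|} -> 15 * d0 < d ->
  2 * m + a <= d0 -> ~~ odd m -> 0 < m ->
  exists i h x p y r (T : {set V}),
   [/\ h < i, exists z, z \in layer Z v i,
       forall t, t < i -> 4 * #|layer Z v t| < #|layer Z v t.+1|,
       (size p).+1 = 2 * m & size r = h.*2.+1] /\
   let F := x :: p ++ y :: r in
   [/\ uniq F, cycle e F & {subset F <= Z}] /\
   [/\ tip_ok (mem T) F, x \notin T, y \notin T, last y r \notin T & count (mem T) p = m].
Proof.
move=> vZ degZ ltd lem om m0.
have [i [P [Q [[PL QL P0 degP degQ] grow]]]] := layer_core vZ degZ ltd.
have /set0Pn[x xP] := P0.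
have [p' [T [[pth uq sz sub lastP] [ok xT lT subT cnt]]]] := triangle_chain degP degQ xP lem.
rewrite (negPf om) in lastP.
case/lastP: p' => [|p y] in pth uq sz sub lastP ok lT subT cnt *.
  by move: sz m0 => /=; clear; lia.
rewrite last_rcons in lastP lT; rewrite size_rcons in sz.
have xL := subsetP PL _ xP; have yL := subsetP PL _ lastP.
have xy : x != y by move: uq; rewrite /= mem_rcons inE negb_or => /andP[/andP[]].
have [h lth [nE E]] := common_ancestor vZ xL yL xy.
have [r [pr ur szr inr]] := tree_closing vZ xL yL lth nE E.
have rlow z : z \in r -> z \notin x :: rcons p y.
  move=> /inr[t ltt zt]; apply/negP => /sub /setUP[/(subsetP PL)|/(subsetP QL)/setUP[]] zi;
  by move: ltt; rewrite (layer_inj zt zi) ?ltnn // ltnNge leqnSn.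
have rT z : z \in r -> z \notin T by move/rlow; apply/contra/subT.
have lrT : last y r \notin T.
  by case: (r) rT => //= z r' rT; apply: rT; exact: mem_last.
exists i, h, x, p, y, r, T; split; split=> //; first by exists x.
- split.
  + rewrite -cat_rcons -cat_cons cat_uniq uq ur andbT /=.
    by apply/hasPn => z /rlow.
  + by rewrite /= rcons_cat -cat_rcons cat_path pth last_rcons pr.
  + move=> z; rewrite -cat_rcons -cat_cons mem_cat => /orP[/sub/setUP[]|/inr[t _]].
    * by move/(subsetP PL)/(subsetP (layer_sub vZ i)).
    * by move/(subsetP QL)/setUP => -[]; apply/subsetP/layer_sub.
    * exact/subsetP/layer_sub.
- split=> //.
  + rewrite -cat_cons; apply: tip_ok_glue => //.
    by apply: tip_ok_none; rewrite /= lT /=; apply/allP => z /rT.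
  + by move: cnt; rewrite /= -cats1 count_cat /= (negPf xT) (negPf lT) /= !addn0 add0n.
Qed.

Lemma mem_split (x : V) s : x \in s -> exists s1 s2, s = s1 ++ x :: s2.
Proof. by case/splitPr=> s1 s2; exists s1, s2. Qed.

Definition has_cycle_of l := exists s, [/\ uniq s, cycle e s & size s = l].

(** * Short cycles *)

Lemma card_layer1 (Z : {set V}) v : v \in Z -> #|layer Z v 1| = #|[set y in Z | e v y]|.
Proof.
move=> vZ; congr #|pred_of_set _|; apply/setP => y; rewrite /= !inE.
have -> : [exists x in [set v], e x y] = e v y.
  apply/existsP/idP => [[x /andP[/set1P->]]//|evy].
  by exists v; rewrite inE eqxx.
by case: eqP => // ->; rewrite e_irr andbF.
Qed.

(** For [l <= 64] the neighbourhood of [v] is already large enough for [layer_cycle]. For larger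
    [l], take a flexible cycle. If its layer index is at least [l %/ 8], geometric growth makes
    layer [l %/ 8] large enough for [layer_cycle]; otherwise the cycle exceeds [l] by at most its
    number [m] of tips, and skipping tips gives length [l]. *)
Lemma short_cycles k (v : V) l : 0 < a -> (forall x, k <= #|[set y | e x y]|) ->
  15 * (l + a + 4) < k -> 62 * a < k -> 3 <= l -> has_cycle_of l.
Proof.
move=> a0 degk kl ka l3.
have vZ : v \in [set: V] by rewrite inE.
have degZ : {in [set: V], forall z, k <= #|[set y in [set: V] | e z y]|}.
  move=> z _; apply: leq_trans (degk z) _; apply/subset_leq_card/subsetP => y.
  by rewrite !inE.
have L1 : k <= #|layer setT v 1| by rewrite card_layer1 //; exact: degZ.
have [l64|l64] := leqP l 64.
  by apply: (@layer_cycle _ _ vZ l 1) => //; nia.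
(* An even number with [l < 2 * m <= l + 4]. *)
pose m := 2 * (l %/ 4).+1.
have [|||i [h [x [p [y [r [T [[lth exi grow szp szr] [[uq cyc _] [ok xT yT _ cnt]]]]]]]]]]
  := @flexible_cycle _ _ k (l + a + 4) m vZ degZ kl.
- by rewrite /m; lia.
- by rewrite /m oddM.
- by rewrite /m; lia.
have [lei|lti] := leqP (l %/ 8) i.
  have grow' j : j < i -> 4 ^ j * #|layer setT v 1| <= #|layer setT v j.+1|.
    elim: j => [|j IH] ltj; first by rewrite mul1n.
    by have := IH (ltnW ltj); have := grow _ ltj; rewrite expnS; nia.
  (* Used for [j = l %/ 8 - 1], which is at least 7 because [l > 64]; then [8 * j + 16] exceeds
     [l - 2]. *)
  have pow j : 7 <= j -> 8 * j + 16 <= 4 ^ j.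
    elim: j => // j IH; rewrite leq_eqVlt => /predU1P[<-//|lej].
    by rewrite expnS; have := IH lej; lia.
  have E8 : l %/ 8 = (l %/ 8).-1.+1 by lia.
  apply: (@layer_cycle _ _ vZ l (l %/ 8)); [|lia|lia].
  have gr : 4 ^ (l %/ 8).-1 * #|layer [set: V] v 1| <= #|layer [set: V] v (l %/ 8)|.
    by rewrite [in X in _ <= X]E8; apply: grow'; lia.
  have := pow (l %/ 8).-1; nia.
pose j := 2 * m + h.*2 + 2 - l.
have [|||p' [pth' sub' sz']] := @tip_remove (mem T) j x p y.
- by move: cyc => /=; rewrite rcons_cat -cat_rcons cat_path => /andP[].
- by move: ok; rewrite -cat_rcons -cat_cons => /tip_ok_catl.
- by rewrite cnt /j /m; lia.
exists (x :: p' ++ y :: r); split.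
- apply: subseq_uniq uq; rewrite /= eqxx; exact: cat_subseq.
- move: cyc; rewrite /= !rcons_cat -!cat_rcons !cat_path !last_rcons pth' /= => /andP[_ ->].
  by [].
- by move: sz' szp; rewrite /= size_cat /= szr /j /m; clear; lia.
Qed.

(** * Long cycles *)

(* The two arcs of [F] between [f1] and [f2] share all but two of the tips. *)
Lemma flexible_arc F (T : {set V}) m f1 f2 : uniq F -> cycle e F -> tip_ok (mem T) F ->
  head f1 F \notin T -> last f1 F \notin T -> m <= count (mem T) F ->
  f1 \in F -> f2 \in F -> f1 != f2 ->
  exists2 sz, sz < size F & forall j, 2 * j + 2 <= m ->
    exists q, [/\ path e f1 (rcons q f2), uniq (f1 :: rcons q f2),
       {subset q <= F} & size q + j = sz].
Proof.
move=> uq cyc ok hT lT cnt.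
suff ordered g1 g2 G1 G2 G3 : F = G1 ++ g1 :: G2 ++ g2 :: G3 ->
    (exists2 sz, sz < size F & forall j, 2 * j + 2 <= m ->
      exists q, [/\ path e g1 (rcons q g2), uniq (g1 :: rcons q g2),
       {subset q <= F} & size q + j = sz]) /\
    (exists2 sz, sz < size F & forall j, 2 * j + 2 <= m ->
      exists q, [/\ path e g2 (rcons q g1), uniq (g2 :: rcons q g1),
       {subset q <= F} & size q + j = sz]).
  move=> /mem_split[G1 [G2 E1]] + nf; rewrite E1 mem_cat inE eq_sym (negPf nf) /=.
  case/orP=> /mem_split[G3 [G4 E2]].
    by have [] := ordered f2 f1 G3 G4 G2; rewrite E1 E2 -?catA.
  by have [] := ordered f1 f2 G1 G3 G4; rewrite E1 E2.
move=> EF.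
have rev_case x y : (exists2 sz, sz < size F & forall j, 2 * j + 2 <= m ->
      exists q, [/\ path e x (rcons q y), uniq (x :: rcons q y),
       {subset q <= F} & size q + j = sz]) ->
   (exists2 sz, sz < size F & forall j, 2 * j + 2 <= m ->
      exists q, [/\ path e y (rcons q x), uniq (y :: rcons q x),
       {subset q <= F} & size q + j = sz]).
  case=> sz ltsz H; exists sz => // j /H[q [pq uq' sub szq]]; exists (rev q); split.
  - rewrite -rev_cons -[rev _]cats0 rev_pathE /= andbT.
    by move: pq; rewrite rcons_path e_sym andbC.
  - rewrite -rev_cons -rev_rcons rev_uniq; exact: uq'.
  - by move=> z; rewrite mem_rev; exact: sub.
  - by rewrite size_rev.
rewrite EF count_cat /= count_cat /= in cnt.
(* One of the two arcs carries at least half of the [m - 2] tips that are not lost at [g1] and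
   [g2]. *)
have [big|small] := leqP m (2 * count (mem T) G2 + 2).
  suff H : exists2 sz, sz < size F & forall j, 2 * j + 2 <= m ->
      exists q, [/\ path e g1 (rcons q g2), uniq (g1 :: rcons q g2),
       {subset q <= F} & size q + j = sz] by split=> //; exact: rev_case.
  exists (size G2) => [|j lej]; first by rewrite EF size_cat /= size_cat /=; lia.
  have okG : tip_ok (mem T) (g1 :: rcons G2 g2).
    by move: ok; rewrite EF => /tip_ok_catr; rewrite -cat_rcons -cat_cons => /tip_ok_catl.
  have pG : path e g1 (rcons G2 g2).
    move: cyc; rewrite EF -(rot_cycle (size G1)) rot_size_cat /= -catA rcons_cat /= -cat_rcons.
    by rewrite cat_path => /andP[].
  have [|q [pq sub szq]] := tip_remove (j := j) pG okG; first lia.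
  have subG : subseq (g1 :: rcons q g2) (g1 :: rcons G2 g2).
    by rewrite /= eqxx -!cats1; exact: cat_subseq.
  exists q; split=> //.
    apply: subseq_uniq subG _; move: uq; rewrite EF cat_uniq => /and3P[_ _].
    by rewrite -cat_rcons -cat_cons cat_uniq => /andP[].
  by move=> z /(mem_subseq sub) zG; rewrite EF mem_cat inE mem_cat zG !orbT.
suff H : exists2 sz, sz < size F & forall j, 2 * j + 2 <= m ->
    exists q, [/\ path e g2 (rcons q g1), uniq (g2 :: rcons q g1),
     {subset q <= F} & size q + j = sz] by split=> //; exact: rev_case.
exists (size (G3 ++ G1)) => [|j lej]; first by rewrite EF !size_cat /= size_cat /=; lia.
(* This arc leaves [F] at its last vertex and re-enters at its head; neither is a tip, so the two
   pieces can be glued. *)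
have okG : tip_ok (mem T) (g2 :: rcons (G3 ++ G1) g1).
  have ok3 : tip_ok (mem T) (g2 :: G3).
    by move: ok; rewrite EF -cat_cons catA => /tip_ok_catr.
  have ok1 : tip_ok (mem T) (rcons G1 g1).
    by move: ok; rewrite EF -cat_rcons => /tip_ok_catl.
  have l3 : last g2 G3 \notin T by move: lT; rewrite EF last_cat /= last_cat.
  have h1 : head g1 (rcons G1 g1) \notin T by move: hT; rewrite EF; case: (G1).
  rewrite rcons_cat -cat_cons (lastI g2 G3) cat_rcons; apply: tip_ok_glue => //.
    by rewrite -lastI.
  by case: (G1) ok1 h1 => [|z G1'] ok1 h1; apply: tip_ok_cons.
have rotF : rot (size (G1 ++ g1 :: G2)) F = g2 :: (G3 ++ G1) ++ g1 :: G2.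
  by rewrite EF -cat_cons catA rot_size_cat /= -catA.
have pG : path e g2 (rcons (G3 ++ G1) g1).
  move: cyc; rewrite -(rot_cycle (size (G1 ++ g1 :: G2))) rotF /= rcons_cat -cat_rcons cat_path.
  by case/andP.
have [|q [pq sub szq]] := tip_remove (j := j) pG okG.
  by rewrite count_cat; move: cnt small lej; case: (_ g1); case: (_ g2) => /=; lia.
have subG : subseq (g2 :: rcons q g1) (g2 :: rcons (G3 ++ G1) g1).
  by rewrite /= eqxx -!cats1; exact: cat_subseq.
exists q; split=> //.
  apply: subseq_uniq subG _; move: uq; rewrite -(rot_uniq (size (G1 ++ g1 :: G2))) rotF.
  by rewrite -cat_rcons -cat_cons cat_uniq => /andP[].
move=> z /(mem_subseq sub) zG; rewrite -(mem_rot (size (G1 ++ g1 :: G2))) rotF.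
by rewrite inE mem_cat zG orbT.
Qed.

Lemma split_first (P : pred V) s : has P s ->
  exists s1 x s2, [/\ s = s1 ++ x :: s2, P x & ~~ has P s1].
Proof.
elim: s => //= y s IH; case Py: (P y) => /=; first by exists [::], y, s.
by case/IH=> s1 [x [s2 [-> Px nh]]]; exists (y :: s1), x, s2; rewrite /= Py.
Qed.

Lemma split_last (P : pred V) s : has P s ->
  exists s1 x s2, [/\ s = s1 ++ x :: s2, P x & ~~ has P s2].
Proof.
rewrite -has_rev => /split_first[s1 [x [s2 [E Px nh]]]].
exists (rev s2), x, (rev s1); split=> //; last by rewrite has_rev.
by rewrite -[s]revK E rev_cat rev_cons cat_rcons.
Qed.

(* [F] is entered at the first and left at the last of its vertices met on [M]; the rest
   of the cycle is short-cut to the right length up to [2 a], which the tips make up for. *)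
Lemma absorb_flexible u M F (T : {set V}) l :
  uniq (u ++ M) -> cycle e (u ++ M) -> l + 2 * a <= size u -> size F < l ->
  {subset F <= M} -> uniq F -> cycle e F -> tip_ok (mem T) F -> 1 < size F ->
  (forall z, head z F \notin T) -> (forall z, last z F \notin T) ->
  4 * a + 2 <= count (mem T) F -> has_cycle_of l.
Proof.
move=> uqC cycC lu szF subF uqF cycF ok F2 hT lT cnt.
have hasF : has (mem F) M.
  case: F F2 subF {szF uqF cycF ok hT lT cnt} => // z F' _ subF.
  by apply/hasP; exists z; rewrite /= ?mem_head //; apply: subF; rewrite mem_head.
have [M1 [f [M2 [EM fF n1]]]] := split_first hasF.
have hasF2 : has (mem F) M2.
  have [z zF zf] : exists2 z, z \in F & z != f.
    case: F F2 uqF {fF n1 hasF subF szF cycF ok hT lT cnt} => [|z [|z' F']] //= _.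
    rewrite inE negb_or => /andP[/andP[zz' _] _].
    have [zf|] := eqVneq z f; last by exists z => //; rewrite mem_head.
    by exists z'; rewrite ?inE ?eqxx ?orbT // eq_sym -zf.
  apply/hasP; exists z => //; have := subF z zF; rewrite EM mem_cat inE (negPf zf) /=.
  by case/orP=> // zM1; case/negP: n1; apply/hasP; exists z.
have [M3 [f' [M4 [EM2 f'F n4]]]] := split_last hasF2.
rewrite {}EM2 in EM.
pose p0 := M4 ++ u ++ rcons M1 f.
have rotC : rot (size (u ++ M1 ++ f :: M3)) (u ++ M) = f' :: p0 ++ M3.
  have -> : u ++ M = (u ++ M1 ++ f :: M3) ++ f' :: M4 by rewrite EM -!catA.
  by rewrite rot_size_cat /p0 /= -!catA cat_rcons.
have uqr : uniq (f' :: p0 ++ M3) by rewrite -rotC rot_uniq.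
have uq0 : uniq (f' :: p0) by move: uqr; rewrite -cat_cons cat_uniq => /andP[].
have pth0 : path e f' p0.
  move: cycC; rewrite -(rot_cycle (size (u ++ M1 ++ f :: M3))) rotC /= rcons_cat cat_path.
  by case/andP.
have last0 : last f' p0 = f by rewrite /p0 !last_cat last_rcons.
have ff' : f != f'.
  move: uq0; rewrite /= /p0 !mem_cat mem_rcons inE !negb_or eq_sym.
  by case/andP=> /and3P[_ _ /andP[]].
have p0F z : z \in p0 -> z \in F -> z = f.
  rewrite /p0 !mem_cat mem_rcons inE => zp zF.
  case/or3P: zp => [z4|zu|/predU1P[//|z1]].
  - by case/negP: n4; apply/hasP; exists z.
  - have := uqC; rewrite cat_uniq => /and3P[_ /hasPn/(_ z (subF z zF))]; by rewrite /= zu.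
  - by case/negP: n1; apply/hasP; exists z.
have [sz ltsz arc] := flexible_arc uqF cycF ok (hT f) (lT f) cnt fF f'F ff'.
have szp0 : l + 2 * a <= size p0.
  by apply: leq_trans lu _; rewrite /p0 !size_cat addnCA leq_addr.
(* The shortened path together with the full arc overshoots [l] by between 1 and [2 * a] vertices.
   Skipping that many tips is allowed, as [2 * (2 * a) + 2] is at most the number of tips. *)
have [|p1 [pth1 sub1 last1 /andP[le1 lt1]]] := @path_shorten (l - sz - 1 + 2 * a) f' p0 pth0 uq0.
  by move: szp0 ltsz szF; clear; lia.
have [|q [pq uq' subq szq]] := arc (size p1 + sz + 1 - l).
  by move: le1 szF ltsz; clear; lia.
exists (f' :: p1 ++ q); split.
- move: uq0 => /= /andP[f'p0 uqp0].
  move: uq'; rewrite /= mem_rcons inE negb_or rcons_uniq => /andP[/andP[_ fq] /andP[f'q uqq]].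
  rewrite mem_cat negb_or f'q andbT cat_uniq uqq (subseq_uniq sub1) // andbT.
  rewrite (contra (mem_subseq sub1 (x := f'))) //=.
  apply/hasPn => z zq; apply/negP => /(mem_subseq sub1) zp0.
  by move: fq; rewrite -(p0F z zp0 (subq _ zq)) zq.
- by rewrite /= rcons_cat cat_path pth1 last1 last0.
- by move: szq lt1 le1 szF ltsz; rewrite /= size_cat; clear; lia.
Qed.

Lemma long_cycles C k l : 0 < a -> uniq C -> cycle e C -> size C = #|V| ->
  (forall x, k <= #|[set y | e x y]|) -> 1000 * a <= k -> 20 * a < l < size C ->
  has_cycle_of l.
Proof.
move=> a0 uqC cycC szC degk ka /andP[al ln].
have memC x : x \in C.
  have [||_ E] := uniq_min_size uqC (s2 := enum V); first by move=> z; rewrite mem_enum.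
    by rewrite szC cardE.
  by rewrite E mem_enum.
pose J := take (l - (2 * a).+1) C.
pose I := drop (l - (2 * a).+1) C.
have EC : C = J ++ I by rewrite cat_take_drop.
have szJ : size J = l - (2 * a).+1 by rewrite size_takel //; lia.
have szI : size I = size C - l + (2 * a).+1 by rewrite size_drop; lia.
have uqJI : uniq (J ++ I) by rewrite -EC.
have [uqJ /hasPn nJI uqI] := and3P (etrans (esym (cat_uniq _ _)) uqJI).
pose T0 := [set v in I | a <= #|[set x in J | e v x]|].
have degI v : k <= #|[set x in J | e v x]| + #|[set x in I | e v x]|.
  apply: leq_trans (degk v) (leq_trans _ (leq_card_setU _ _).1).
  apply/subset_leq_card/subsetP => x; rewrite !inE => evx.
  by rewrite evx !andbT -mem_cat -EC.
have cardI (s : seq V) : #|[set x in s]| <= size s by rewrite cardsE card_size.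
case EI: I => [|y0 I']; first by move: szI; rewrite EI /=; lia.
have pI : path e y0 I'.
  by move: cycC; rewrite EC EI -(rot_cycle (size J)) rot_size_cat /= rcons_cat cat_path => /andP[].
(* Shrinking [I] to at most [2 * a + 1] vertices brings the cycle down to at most [l] vertices.
   Enough vertices of [T0] have dropped out to be reinserted until the length is [l]. *)
have [big|small] := boolP ((4 * a + 2 <= #|T0|) || (#|T0| == size I)).
  have [||p' [pth' sub' last' /andP[sz1 _]]] := @path_shorten (2 * a) y0 I' pI.
  - by rewrite -EI.
  - by move: szI; rewrite EI /=; lia.
  pose D := J ++ y0 :: p'.
  have subD : subseq D C by rewrite EC EI; apply: cat_subseq => //; rewrite /= eqxx.
  have cycD : cycle e D.
    move: cycC; rewrite EC EI /D -(rot_cycle (size J)) rot_size_cat.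
    rewrite -[in X in _ -> X](rot_cycle (size J)) rot_size_cat /= !rcons_cat !cat_path pth' last'.
    by case/andP.
  have szD : size D = l - (2 * a).+1 + (size p').+1 by rewrite size_cat szJ.
  pose T := T0 :\: [set x in y0 :: p'].
  have cT : #|T0| <= #|T| + (size p').+1.
    have := cardsD T0 [set x in y0 :: p']; have := cardI (y0 :: p').
    have := subset_leq_card (subsetIr T0 [set x in y0 :: p']).
    by rewrite -/T /=; clear; lia.
  have [|||D' [uqD' cycD' szD']] := @cycle_insert_set D T (l - size D) _ cycD a0.
  - exact: subseq_uniq subD uqC.
  - move=> t /setDP[/setIdP[tI tN]]; rewrite inE => tp; split.
      by rewrite mem_cat negb_or tp andbT; exact: nJI.
    apply: leq_trans tN _; apply/subset_leq_card/subsetP => x.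
    by rewrite !inE mem_cat => /andP[-> ->].
  - case/orP: big => [|/eqP]; move: cT szD szI sz1 al ln; clear; lia.
  by exists D'; split=> //; move: szD' szD sz1 al; clear; lia.
move: small; rewrite negb_or -ltnNge => /andP[T0small T0I].
(* If [I] were short, every vertex would have at least [k - size I >= a] neighbours on [J], and [T0]
   would be all of [I]. *)
have far : 20 * a < size C - l.
  rewrite ltnNge; apply/negP => near; case/negP: T0I.
  have -> : T0 = [set v in I].
    apply/setP => v; rewrite !inE; case vI: (v \in I) => //=.
    have leI : #|[set x in I | e v x]| <= size I.
      by apply: leq_trans (cardI I); apply/subset_leq_card/subsetP => x; rewrite !inE => /andP[].
    rewrite -(leq_add2r #|[set x in I | e v x]|); apply: leq_trans (degI v).
    by apply: leq_trans (leq_add (leqnn a) leI) _; move: szI near ka a0; clear; lia.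
  by rewrite cardsE; apply/eqP/card_uniqP.
(* Handing the first [4 * a + 5] vertices of [I] over to [J] gives an initial segment of
   [l + 2 * a + 4] vertices, long enough for [absorb_flexible]. *)
pose c := l - (2 * a).+1 + (4 * a + 5).
pose M := drop c C.
have szM : size M = size C - l - 2 * a - 4 by rewrite size_drop /c; move: al; clear; lia.
have ECM : C = take c C ++ M by rewrite cat_take_drop.
have MI : {subset M <= I}.
  by move=> x; rewrite /M /c addnC -drop_drop => /mem_drop.
pose W := [set v in M | v \notin T0].
have [v vW] : exists v, v \in W.
  apply/card_gt0P; have -> : W = [set x in M] :\: T0 by apply/setP => x; rewrite !inE andbC.
  have : #|[set x in M]| = size M by rewrite cardsE; apply/card_uniqP/drop_uniq.
  have := cardsD [set x in M] T0; have := subset_leq_card (subsetIr [set x in M] T0).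
  by move: szM far T0small a0; clear; lia.
have degW : {in W, forall z, k - 15 * a <= #|[set y in W | e z y]|}.
  move=> z /setIdP[zM zT0].
  have zJ : #|[set x in J | e z x]| < a.
    by rewrite ltnNge; apply: contra zT0; rewrite inE (MI _ zM).
  have Isplit : #|[set x in I | e z x]| <= #|[set y in W | e z y]| + #|T0| +
      #|[set x in take (4 * a + 5) I]|.
    apply: leq_trans (leq_add (leq_card_setU _ _).1 (leqnn _)).
    apply: leq_trans (leq_card_setU _ _).1; apply/subset_leq_card/subsetP => x.
    rewrite in_setU in_setU !(in_set, inE) => /andP[xI ezx]; rewrite xI ezx.
    have := xI; rewrite -{1}(cat_take_drop (4 * a + 5) I) mem_cat drop_drop (addnC (4 * a + 5)) -/c -/M.
    by case/orP=> ->; rewrite ?orbT //= andbT; case: (a <= _); rewrite ?orbT.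
  have sztk : size (take (4 * a + 5) I) <= 4 * a + 5 by rewrite size_take_min geq_minl.
  have arith n1 n2 n3 n4 n5 n6 : n1 < a -> k <= n1 + n2 -> n2 <= n3 + n4 + n5 ->
    n5 <= n6 -> n6 <= 4 * a + 5 -> n4 < 4 * a + 2 -> k - 15 * a <= n3.
    by move: ka a0; clear; lia.
  exact: arith zJ (degI z) Isplit (cardI _) sztk T0small.
(* [absorb_flexible] needs [4 * a + 2] tips, an even number, and [9 * a + 4] is
   [2 * (4 * a + 2) + a]. *)
have [||||i [h [x [p [y [r [T [[lth [z zi] _ szp szr] /=
  [[uq cyc sub] [ok xT yT lT cnt]]]]]]]]]] := flexible_cycle (m := 4 * a + 2) (d0 := 9 * a + 4) vW degW.
- by move: ka a0; clear; lia.
- by clear; lia.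
- by rewrite oddD oddM.
- by clear; lia.
(* The search tree is shallow, so the flexible cycle has at most [12 * a + 2] vertices, fewer than
   [l]. *)
have ia : i < 2 * a := layer_bound vW a0 zi.
apply: (@absorb_flexible (take c C) M (x :: p ++ y :: r) T l) => //.
- by rewrite -ECM.
- by rewrite -ECM.
- by rewrite size_takel; move: al far a0; rewrite /c; clear; lia.
- by rewrite /= size_cat /= szr; move: szp ia lth al a0; move: (size p) => s; clear; lia.
- by move=> w /sub /setIdP[].
- by rewrite /= size_cat /= szr; clear; lia.
- by move=> w /=; rewrite last_cat.
- by rewrite /= count_cat cnt addnCA leq_addr.
Qed.

Theorem hamiltonian_pancyclic C k : 0 < a -> uniq C -> cycle e C -> size C = #|V| ->
  (forall x, k <= #|[set y | e x y]|) -> 1000 * a <= k ->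
  forall l, 3 <= l <= size C -> has_cycle_of l.
Proof.
move=> a0 uqC cycC szC degk ka l /andP[l3 ln].
have [small|big] := leqP l (20 * a).
  case: C uqC cycC szC ln => [|v C'] _ _ _ ln; first by move: l3 ln => /=; lia.
  by apply: (short_cycles v a0 degk) => //; lia.
move: ln; rewrite leq_eqVlt => /predU1P[->|ln]; first by exists C.
by apply: (long_cycles a0 uqC cycC szC degk ka); rewrite big.
Qed.

End Pancyclicity.

(** * Degrees and independence numbers *)

Section GraphFacts.
Variable n : nat.
Implicit Types (E S : graph n) (x y : 'I_n).

Lemma adj_sym E : symmetric (adj E).
Proof. by move=> x y; rewrite /adj eq_sym setUC. Qed.

Lemma adj_irr E : irreflexive (adj E).
Proof. by move=> x; rewrite /adj eqxx. Qed.

Lemma adjU E S x y : adj (E :|: S) x y = adj E x y || adj S x y.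
Proof. by rewrite /adj in_setU andb_orr. Qed.

Lemma mem_full_tuple (C : n.-tuple 'I_n) : uniq C -> forall x, x \in C.
Proof.
move=> uqC x; have [||_ E] := uniq_min_size uqC (s2 := enum 'I_n).
- by move=> z; rewrite mem_enum.
- by rewrite size_enum_ord size_tuple.
- by rewrite E mem_enum.
Qed.

Lemma mindeg_le E x : mindeg E <= deg E x.
Proof.
rewrite /mindeg; have := mem_index_enum x.
elim: (index_enum _) => // y r IH; rewrite big_cons inE => /predU1P[->|/IH].
  exact: geq_minl.
by move=> le; apply: leq_trans (geq_minr _ _) le.
Qed.

Lemma mindeg_ge E k : k <= n -> (forall x, k <= deg E x) -> k <= mindeg E.
Proof.
move=> kn degk; rewrite /mindeg; apply: (big_ind (fun m => k <= m)) => // m1 m2.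
by rewrite leq_min => -> ->.
Qed.

Lemma deg_lt E x : deg E x < n.
Proof.
rewrite -[X in _ < X]card_ord -cardsT; apply: proper_card; apply/properP; split.
  exact: subsetT.
by exists x; rewrite !inE // adj_irr.
Qed.

Lemma mindegU E S : mindeg E <= mindeg (E :|: S).
Proof.
apply: mindeg_ge => [|x].
  rewrite /mindeg; elim/big_rec: _ => // x m _ le.
  by apply: leq_trans (geq_minr _ _) le.
apply: leq_trans (mindeg_le E x) _; apply/subset_leq_card/subsetP => y.
by rewrite !inE adjU => ->.
Qed.

Lemma indepP E (A : {set 'I_n}) :
  reflect (forall x y, x \in A -> y \in A -> ~~ adj E x y) (indep E A).
Proof.
apply: (iffP forallP) => [H x y xA yA|H x].
  by have := H x; rewrite xA => /forallP/(_ y); rewrite yA.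
by apply/implyP => xA; apply/forallP => y; apply/implyP => yA; exact: H.
Qed.

Lemma indep_le_alpha E (A : {set 'I_n}) : indep E A -> #|A| <= alpha E.
Proof. by move=> iA; exact: (leq_bigmax_cond A iA). Qed.

Lemma alpha_le E m : (forall A : {set 'I_n}, indep E A -> #|A| <= m) -> alpha E <= m.
Proof. by move=> H; apply/bigmax_leqP. Qed.

Lemma alpha_bound E (A : {set 'I_n}) : alpha E < #|A| ->
  exists x y, [/\ x \in A, y \in A & adj E x y].
Proof.
move=> lt; have : ~~ indep E A by apply/negP => /indep_le_alpha; rewrite leqNgt lt.
case/forallPn=> x; rewrite negb_imply => /andP[xA /forallPn[y]].
by rewrite negb_imply => /andP[yA /negPn exy]; exists x, y.
Qed.

Lemma alphaU E S : alpha (E :|: S) <= alpha E.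
Proof.
apply: alpha_le => A /indepP iA; apply: indep_le_alpha; apply/indepP => x y xA yA.
by have := iA x y xA yA; rewrite adjU negb_or => /andP[].
Qed.

Lemma alpha_gt0 E x : 0 < alpha E.
Proof.
rewrite -(cards1 x); apply: indep_le_alpha; apply/indepP => y z /set1P-> /set1P->.
by rewrite adj_irr.
Qed.

Lemma pancyclic_of_hamiltonian E : hamiltonian E -> 1000 * alpha E <= mindeg E ->
  pancyclic E.
Proof.
case/andP=> n3 /existsP[C /andP[uqC cycC]] aE.
apply/forallP => l; apply/implyP => l3.
have [|||s [uqs cycs szs]] :=
  @hamiltonian_pancyclic _ (adj E) (alpha E) (adj_sym E) (adj_irr E) (@alpha_bound E)
    C (mindeg E) _ uqC cycC _ (mindeg_le E) aE l.
- exact: (alpha_gt0 E (Ordinal n3)).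
- by rewrite size_tuple card_ord.
- by rewrite size_tuple l3 -ltnS /=.
by apply/existsP; exists (tcast szs (in_tuple s)); rewrite !val_tcast uqs.
Qed.

End GraphFacts.

(** * The random graph *)

Local Open Scope ring_scope.

Lemma bernoulli (R : realType) (p : R) b : 0 <= p <= 1 -> 1 - b%:R * p <= (1 - p) ^+ b.
Proof.
case/andP=> p0 p1; elim: b => [|s IH]; first by rewrite mul0r subr0 expr0.
rewrite exprS -natr1; apply: le_trans (_ : (1 - p) * (1 - s%:R * p) <= _); last first.
  by apply: ler_wpM2l => //; rewrite subr_ge0.
have : 0 <= s%:R * p * p by rewrite !mulr_ge0 ?ler0n.
by nra.
Qed.

Section Expectation.
Variables (R : realType) (n : nat) (p : R).
Hypothesis p01 : 0 <= p <= 1.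

Definition expect (f : graph n -> R) : R :=
  \sum_(S : graph n | S \subset pairs n)
     p ^+ #|S| * (1 - p) ^+ (#|pairs n| - #|S|) * f S.

Let p_ge0 : 0 <= p. Proof. by case/andP: p01. Qed.
Let q_ge0 : 0 <= 1 - p. Proof. by rewrite subr_ge0; case/andP: p01. Qed.

Lemma expect_le f g : (forall S : graph n, S \subset pairs n -> f S <= g S) ->
  expect f <= expect g.
Proof.
move=> fg; apply: ler_sum => S HS; apply: ler_wpM2l; last exact: fg.
by rewrite mulr_ge0 ?exprn_ge0.
Qed.

Lemma expectD f g : expect (fun S => f S + g S) = expect f + expect g.
Proof. by rewrite -big_split; apply: eq_bigr => S _; rewrite mulrDr. Qed.

Lemma expectZ c f : expect (fun S => c * f S) = c * expect f.
Proof. by rewrite big_distrr; apply: eq_bigr => S _ /=; rewrite mulrCA. Qed.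

Lemma expect_sum (I : finType) (P : pred I) (f : I -> graph n -> R) :
  expect (fun S => \sum_(i | P i) f i S) = \sum_(i | P i) expect (f i).
Proof. by rewrite exchange_big; apply: eq_bigr => S _ /=; rewrite big_distrr. Qed.

Lemma expect_avoid (B : graph n) : B \subset pairs n ->
  expect (fun S => ([disjoint S & B])%:R) = (1 - p) ^+ #|B|.
Proof.
move=> BP.
(* [F e] and [G e] are the weights of [e] being present and absent. Expanding the product of all
   [F e + G e] gives the sum over [S], in which the sets meeting [B] get weight 0. *)
pose F e : R := if e \in pairs n :\: B then p else 0.
pose G e : R := if e \in pairs n then 1 - p else 1.
transitivity (\prod_(e : {set 'I_n}) (F e + G e)); last first.
  rewrite -prodr_const [RHS]big_mkcond; apply: eq_bigr => e _; rewrite /F /G !inE.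
  case eB: (e \in B) => /=; last by case: ifP => _; rewrite ?add0r // addrC subrK.
  by have := subsetP BP _ eB; rewrite inE => ->; rewrite add0r.
rewrite bigA_distr /expect [LHS]big_mkcond [RHS]big_mkcond; apply: eq_bigr => S _.

case: ifP => [SP|/negbT SP]; last first.
  have /subsetPn[e eS eP] := SP.
  by rewrite (bigD1 e) //= eS /F inE (negPf eP) andbF mul0r.
have [dSB|ndSB] := boolP [disjoint S & B]; last first.
  have /exists_inP[e eS eB] : [exists e in S, e \in B].
    by move: ndSB; rewrite -setI_eq0 => /set0Pn[e /setIP[eS eB]]; apply/exists_inP; exists e.
  by rewrite (bigD1 e) //= eS /F inE eB /= mul0r mulr0.
rewrite mulr1 (bigID (mem S)) /=; congr (_ * _).
  rewrite -prodr_const; apply: eq_bigr => e eS; rewrite eS /F inE (subsetP SP _ eS) andbT.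
  by have -> : e \in B = false by apply: disjointFr eS.
have -> : (#|pairs n| - #|S|)%N = #|pairs n :\: S| by rewrite cardsD (setIidPr SP).
rewrite -prodr_const big_mkcond [RHS]big_mkcond.
by apply: eq_bigr => e _; rewrite !inE /G inE; case: (e \in S) => //=; case: ifP.
Qed.

Lemma expect_cst c : expect (fun=> c) = c.
Proof.
have := expect_avoid (sub0set _); rewrite cards0 expr0 => E1.
rewrite -[RHS]mulr1 -[in RHS]E1 -expectZ; apply: eq_bigr => S _.
by rewrite disjoint_sym disjoints_subset sub0set mulr1.
Qed.

(* Chebyshev's inequality for the number [X] of sets [B i] avoided by the random graph. *)
Lemma second_moment (I : finType) (A : pred I) (B : I -> graph n) (b r : nat) (t : R)
   (m := #|A|%:R : R) (mu := m * (1 - p) ^+ b)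
   (X := fun S : graph n => \sum_(i | A i) ([disjoint S & B i])%:R : R) :
  (forall i, A i -> B i \subset pairs n) -> (forall i, A i -> #|B i| = b) ->
  (forall i j, A i -> A j -> i != j -> (2 * b <= #|B i :|: B j| + r)%N) -> (r <= 2 * b)%N ->
  t < mu ->
  expect (fun S => ((X S <= t)%R)%:R) <=
    (mu + m ^+ 2 * (1 - p) ^+ (2 * b - r) * (r%:R * p)) / (mu - t) ^+ 2.
Proof.
move=> BP cB cBB r2b tmu.
have mut : 0 < (mu - t) ^+ 2 by rewrite exprn_gt0 // subr_gt0.
rewrite ler_pdivlMr // mulrC -expectZ.
have step1 : expect (fun S => (mu - t) ^+ 2 * ((X S <= t)%R)%:R) <=
    expect (fun S => X S ^+ 2 + (- (2 * mu) * X S + mu ^+ 2)).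
  apply: expect_le => S _.
  have -> : X S ^+ 2 + (- (2 * mu) * X S + mu ^+ 2) = (X S - mu) ^+ 2 by ring.
  have [le|_] := boolP (X S <= t); last by rewrite mulr0 sqr_ge0.
  have le' := le_lt_trans le tmu.
  rewrite mulr1 -(sqrrN (X S - mu)) opprB.
  by rewrite ler_pXn2r ?nnegrE ?subr_ge0 ?(ltW tmu) ?(ltW le') // lerD2l lerN2.
apply: le_trans step1 _.
rewrite !expectD expectZ expect_cst.
have EX : expect X = mu.
  rewrite expect_sum (eq_bigr (fun=> (1 - p) ^+ b)) => [|i Ai]; last by rewrite expect_avoid ?BP // cB.
  by rewrite sumr_const /mu /m mulr_natl.
(* The diagonal pairs contribute [mu]; for the others the union of the two sets has at least
   [2 * b - r] elements. *)
have EX2 : expect (fun S => X S ^+ 2) <= mu + m ^+ 2 * (1 - p) ^+ (2 * b - r).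
  have -> : expect (fun S => X S ^+ 2) =
      \sum_(i | A i) \sum_(j | A j) (1 - p) ^+ #|B i :|: B j|.
    transitivity (\sum_(i | A i) expect (fun S => \sum_(j | A j) ([disjoint S & B i :|: B j])%:R)).
      rewrite -expect_sum; apply: eq_bigr => S _; congr (_ * _).
      rewrite expr2 big_distrl; apply: eq_bigr => i _ /=; rewrite big_distrr.
      apply: eq_bigr => j _ /=; rewrite -natrM mulnb.
      by rewrite -!setI_eq0 setIUr setU_eq0.
    apply: eq_bigr => i Ai; rewrite expect_sum; apply: eq_bigr => j Aj.
    by rewrite expect_avoid // subUset !BP.
  have q1 : 1 - p <= 1 by rewrite gerBl.
  have rowle i : A i -> \sum_(j | A j) (1 - p) ^+ #|B i :|: B j| <=
      (1 - p) ^+ b + m * (1 - p) ^+ (2 * b - r).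
    move=> Ai; rewrite (bigD1 i) //= setUid cB // lerD2l.
    apply: le_trans (_ : \sum_(j | A j) (1 - p) ^+ (2 * b - r) <= _); last first.
      by rewrite sumr_const mulr_natl.
    rewrite [leRHS](bigD1 i) //= -[leLHS]add0r; apply: lerD; first exact: exprn_ge0.
    apply: ler_sum => j /andP[Aj ji].
    apply: ler_wiXn2l => //; rewrite leq_subLR addnC; apply: cBB => //; by rewrite eq_sym.
  apply: le_trans (ler_sum _ rowle) _.
  by rewrite sumr_const -mulr_natl -/m /mu mulrDr expr2 mulrA.
rewrite EX.
(* By Bernoulli, [(1 - p) ^+ (2 * b - r) * (1 - r%:R * p)] is at most [(1 - p) ^+ (2 * b)], so the
   second moment exceeds [mu ^+ 2] by at most [mu] plus the term with [r%:R * p]. *)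
have bern := bernoulli r p01.
have : m ^+ 2 * (1 - p) ^+ (2 * b - r) * (1 - r%:R * p) <= mu ^+ 2.
  rewrite /mu exprMn -mulrA; apply: ler_wpM2l; first exact: sqr_ge0.
  rewrite -exprM (mulnC b 2) -[in leRHS](subnK r2b) exprD; apply: ler_wpM2l bern.
  exact: exprn_ge0.
move: EX2; set Y := m ^+ 2 * _; set W := expect _; move=> h1 h2.
have -> : - (2 * mu) * mu + mu ^+ 2 = - mu ^+ 2 by ring.
have := h2; rewrite mulrBr mulr1 => {}h2; lra.
Qed.

End Expectation.

(** * From bounds for each n to limits *)

Section Asymptotics.
Variable R : realType.

Lemma aas_of_le (u : nat -> R) : ev (fun n => u n <= 1) ->
  (forall eps : R, 0 < eps -> ev (fun n => 1 - eps <= u n)) -> aas u.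
Proof.
move=> [N0 le1] H; apply/cvgrPdist_le => eps eps0.
have [N HN] := H _ eps0; exists (maxn N0 N) => // n /=.
rewrite geq_max => /andP[/le1 un1 /HN un].
by rewrite ger0_norm ?subr_ge0 // lerBlDr addrC -lerBlDr.
Qed.

Lemma prob_union_le1 n (E : graph n) (p : R) P : 0 <= p <= 1 -> prob_union E p P <= 1.
Proof.
move=> p01; rewrite -[leRHS](expect_cst n p).
by apply: expect_le => // S _; rewrite lern1 leq_b1.
Qed.

Lemma prob_union_ge n (E : graph n) (p : R) (P : graph n -> bool) (f : graph n -> R) : 0 <= p <= 1 ->
  (forall S : graph n, S \subset pairs n -> 1 - f S <= (P (E :|: S))%:R) ->
  1 - expect p f <= prob_union E p P.
Proof.
move=> p01 H; rewrite -[X in X - _](expect_cst n p) -mulN1r -expectZ -expectD.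
by apply: expect_le => // S HS; rewrite mulN1r; exact: H.
Qed.

End Asymptotics.

(** * Graphs defined by a relation, and counting lemmas *)

Section RelGraph.
Variables (n : nat) (r : rel 'I_n).
Hypothesis r_sym : symmetric r.

Definition rel_graph : graph n :=
  [set e in pairs n | [forall x in e, forall y in e, (x != y) ==> r x y]].

Lemma rel_graph_simple : simple_graph rel_graph.
Proof. by apply/subsetP => e; rewrite inE => /andP[]. Qed.

Lemma rel_graphE x y : adj rel_graph x y = (x != y) && r x y.
Proof.
rewrite /adj; case: (boolP (x != y)) => //= xy; rewrite !inE cards2 xy /=.
apply/forallP/idP => [/(_ x)|rxy u].
  rewrite !inE eqxx /= => /forallP/(_ y); by rewrite !inE eqxx orbT xy.
apply/implyP; rewrite !inE => ux; apply/forallP => v; apply/implyP; rewrite !inE => vy.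
apply/implyP; case/orP: ux => /eqP->; case/orP: vy => /eqP->; rewrite ?eqxx //.
by rewrite r_sym.
Qed.

End RelGraph.

Lemma set2_inj (T : finType) (i : T) : {in predC1 i &, injective (fun y => [set i; y])}.
Proof.
move=> y z yi zi /setP/(_ y); rewrite !inE eqxx orbT (negPf (yi : y != i)) /=.
by move/esym/eqP.
Qed.

Lemma card_cut_inter n (Bi Bj : graph n) (i j : 'I_n) : i != j ->
  (forall e, e \in Bi -> i \in e /\ #|e| = 2%N) ->
  (forall e, e \in Bj -> j \in e /\ #|e| = 2%N) -> (#|Bi :&: Bj| <= 1)%N.
Proof.
move=> ij Hi Hj; rewrite -(cards1 [set i; j]); apply/subset_leq_card/subsetP => e.
case/setIP=> /Hi[ie e2] /Hj[je _]; rewrite inE eq_sym eqEcard e2 cards2 ij andbT.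
by apply/subsetP => z; rewrite !inE => /orP[]/eqP->.
Qed.

Lemma card_ord_itv n u h : (u + h <= n)%N ->
  #|[set y : 'I_n | (u <= y < u + h)%N]| = h.
Proof.
move=> uhn.
have lt (i : 'I_h) : (u + i < n)%N by apply: leq_trans uhn; rewrite ltn_add2l.
pose f (i : 'I_h) := Ordinal (lt i).
have f_inj : injective f by move=> i j /(congr1 val) /= /addnI /val_inj.
rewrite -[RHS]card_ord -cardsT -(card_imset _ f_inj); congr #|pred_of_set _|.
apply/setP => y; rewrite inE; apply/idP/imsetP => [/andP[uy yuh]|[i _ ->]].
  have lti : (y - u < h)%N by lia.
  by exists (Ordinal lti) => //; apply: val_inj => /=; rewrite subnKC.
by rewrite /= leq_addr ltn_add2l ltn_ord.
Qed.

(** * An independent set attached to a small hub *)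

Section HubGraph.
Variables (n k : nat).
Let h := uphalf k.
Hypothesis k0 : (0 < k)%N.
Hypothesis kn : (k - 1 + h < n)%N.

(* The vertices below [k - 1] are independent and joined to the hub
   [k - 1, ..., k - 1 + uphalf k - 1] only; the other vertices form a clique. *)
Definition hub_rel : rel 'I_n := fun x y =>
  ((x < k - 1)%N ==> (k - 1 <= y < k - 1 + uphalf k)%N) &&
  ((y < k - 1)%N ==> (k - 1 <= x < k - 1 + uphalf k)%N).

Lemma hub_rel_sym : symmetric hub_rel.
Proof. by move=> x y; rewrite /hub_rel andbC. Qed.

Definition hub_graph := rel_graph hub_rel.

Definition hub : {set 'I_n} := [set y : 'I_n | (k - 1 <= y < k - 1 + h)%N].

Lemma card_hub : #|hub| = h.
Proof. by rewrite card_ord_itv // ltnW. Qed.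

Lemma hubP (y : 'I_n) : (y \in hub) = (k - 1 <= y < k - 1 + uphalf k)%N.
Proof. by rewrite inE. Qed.

Lemma hub_adj x y : adj hub_graph x y = [&& x != y, (x < k - 1)%N ==> (y \in hub) &
  (y < k - 1)%N ==> (x \in hub)].
Proof. by rewrite rel_graphE ?hubP //; exact: hub_rel_sym. Qed.

(** An independent set has at most [k - 1] vertices below [k - 1] and at most one in the clique.
    Equality holds for all the low vertices together with the first vertex past the hub. *)
Lemma hub_alpha : alpha hub_graph = k.
Proof.
apply/eqP; rewrite eqn_leq; apply/andP; split.
  apply: alpha_le => A /indepP iA.
  rewrite -(cardsID [set y : 'I_n | (y < k - 1)%N] A).
  apply: (@leq_trans (k - 1 + 1)); last by rewrite subnK.
  apply: leq_add.
    apply: leq_trans (subset_leq_card (subsetIr _ _)) _.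
    have -> : [set y : 'I_n | (y < k - 1)%N] = [set y : 'I_n | (0 <= y < 0 + (k - 1))%N].
      by apply/setP => y; rewrite !inE.
    rewrite card_ord_itv //; lia.
  rewrite leqNgt; apply/negP => /card_gt1P[x [y [/setDP[xA xI] /setDP[yA yI] xy]]].
  have := iA x y xA yA; rewrite hub_adj xy; move: xI yI; rewrite !inE.
  by move=> /negPf-> /negPf->.
have hn : (k - 1 + h < n)%N by [].
pose A := [set y : 'I_n | (y < k - 1)%N || (y == Ordinal hn)].
have cA : #|A| = k.
  have -> : A = Ordinal hn |: [set y : 'I_n | (0 <= y < 0 + (k - 1))%N].
    by apply/setP => y; rewrite !inE orbC.
  rewrite cardsU1 card_ord_itv; last lia.
  by rewrite !inE /= ltnNge add0n leq_addr /= add1n subn1 prednK.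
rewrite -{1}cA; apply: indep_le_alpha; apply/indepP => x y; rewrite !inE => xA yA.
rewrite hub_adj !hubP; apply/negP => /and3P[xy Hx Hy].
case/orP: xA => [xI|/eqP xB].
  case/orP: yA => [yI|/eqP yB].
    by move: Hx; rewrite xI /= leqNgt yI.
  by move: Hx; rewrite xI yB /= ltnn andbF.
case/orP: yA => [yI|/eqP yB].
  by move: Hy; rewrite yI xB /= ltnn andbF.
by rewrite xB yB eqxx in xy.
Qed.

Lemma hub_mindeg : (k <= 2 * mindeg hub_graph)%N.
Proof.
suff : (h <= mindeg hub_graph)%N by rewrite /h; have := odd_double_half k; have := uphalf_half k; lia.
apply: mindeg_ge => [|x]; first lia.
have [xH|xH] := boolP (x \in hub).
  have -> : deg hub_graph x = n.-1.
    rewrite -[n in RHS]card_ord -cardsT (cardsD1 x setT) inE /= add0n.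
    congr #|pred_of_set _|; apply/setP => y; rewrite !inE hub_adj xH implybT !andbT eq_sym andbC.
    move: xH; rewrite hubP => /andP[kx _]; rewrite (ltnNge x) kx /=.
    by case: (y != x).
  lia.
rewrite -card_hub /deg; apply/subset_leq_card/subsetP => y yH; rewrite inE hub_adj yH implybT /=.
apply/andP; split; first by apply: contraNneq xH => ->.
by move: yH; rewrite hubP => /andP[ky _]; rewrite (ltnNge y) ky.
Qed.

Definition hub_cut (i : 'I_n) : graph n := [set [set i; y] | y in ~: hub :\ i].

Lemma hub_cutP (i : 'I_n) e : e \in hub_cut i -> i \in e /\ #|e| = 2%N.
Proof.
case/imsetP=> y; rewrite !inE => /andP[yi _] ->.
by rewrite !inE eqxx cards2 eq_sym yi.
Qed.

Lemma hub_cut_pairs i : hub_cut i \subset pairs n.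
Proof. by apply/subsetP => e /hub_cutP[_ e2]; rewrite inE e2. Qed.

Lemma card_hub_cut (i : 'I_n) : (i < k - 1)%N -> #|hub_cut i| = (n - h - 1)%N.
Proof.
move=> ik; rewrite card_in_imset => [|y z]; last first.
  by rewrite !inE => /andP[yi _] /andP[zi _]; apply: (@set2_inj _ i).
have cC : #|~: hub| = (n - h)%N by rewrite cardsCs setCK card_hub card_ord.
have iC : i \in ~: hub by rewrite in_setC hubP leqNgt ik.
by have := cardsD1 i (~: hub); rewrite cC iC add1n => ->; rewrite subn1.
Qed.

(** On a Hamilton cycle the successors of the counted vertices are distinct and all lie in the hub,
    which is too small for them. *)
Lemma hub_not_hamiltonian (S : graph n) :
  (h < #|[set i : 'I_n | (i < k - 1)%N & [disjoint S & hub_cut i]]|)%N ->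
  ~~ hamiltonian (hub_graph :|: S).
Proof.
move=> big; apply/negP => /andP[n3 /existsP[C /andP[uqC cycC]]].
set I0 := [set i | _ & _] in big.
have memC := mem_full_tuple uqC.
have nxt_inj : injective (next C) := can_inj (prev_next uqC).
suff sub : next C @: I0 \subset hub.
  by have := subset_leq_card sub; rewrite card_imset // card_hub leqNgt big.
apply/subsetP => y /imsetP[i]; rewrite inE => /andP[ik dis] ->.
have := next_cycle cycC (memC i); set z := next C i.
rewrite adjU => /orP[|/andP[iz izS]].
  by rewrite hub_adj ik => /and3P[_ ].
apply/negPn/negP => nz; move: dis => /pred0P/(_ [set i; z]) /=; rewrite izS /=.
by move=> /negbT/negP; apply; apply: imset_f; rewrite !inE eq_sym iz -hubP nz.
Qed.

(** Each low vertex keeps all its neighbours in the hub with probability at least 2/3, so the mean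
    number of such vertices is at least [2 / 3 * (k - 1)], well above the hub size. Two cuts share
    at most one pair, whence the value 1 for [r] in [second_moment]. *)
Lemma hub_prob (R : realType) (p : R) : 0 <= p <= 1 -> p <= 1 / (3 * n%:R) -> (14 <= k)%N ->
  1 - 288 / k%:R <= prob_union hub_graph p (fun E => ~~ hamiltonian E).
Proof.
move=> p01 pn k14; have [p0 p1] := andP p01.
pose X (S : graph n) : R := \sum_(i : 'I_n | (i < k - 1)%N) ([disjoint S & hub_cut i])%:R.
have XE S : X S = #|[set i : 'I_n | (i < k - 1)%N & [disjoint S & hub_cut i]]|%:R.
  rewrite /X -sum1dep_card natr_sum big_mkcondr /=.
  by apply: eq_bigr => i _; case: [disjoint _ & _].
apply: le_trans (@prob_union_ge R n hub_graph p _ (fun S => ((X S <= h%:R)%R)%:R) p01 _); last first.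
  move=> S _; case: (leP (X S) h%:R) => [_|]; first by rewrite subrr ler0n.
  by rewrite XE ltr_nat => /hub_not_hamiltonian->; rewrite subr0.
rewrite lerD2l lerN2.
have cI : #|[pred i : 'I_n | (i < k - 1)%N]| = (k - 1)%N.
  rewrite -[RHS](@card_ord_itv n 0) ?add0n; last lia.
  by rewrite cardsE; apply: eq_card => i; rewrite !inE.
have n0 : 0 < n%:R :> R by rewrite ltr0n; lia.
have bp : (n - h - 1)%:R * p <= 1 / 3.
  apply: le_trans (_ : n%:R * p <= _); first by apply: ler_wpM2r; rewrite // ler_nat; move: kn; clear; lia.
  apply: le_trans (ler_wpM2l (ltW n0) pn) _.
  by rewrite le_eqVlt; apply/orP; left; apply/eqP; field; rewrite gt_eqF.
have q23 : 2 / 3 <= (1 - p) ^+ (n - h - 1).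
  by apply: le_trans (bernoulli _ p01); lra.
have q1 : (1 - p) ^+ (n - h - 1) <= 1 by apply: exprn_ile1; lra.
set m : R := (k - 1)%:R.
have mE : m = k%:R - 1 by rewrite /m natrB.
have hk : h%:R <= (k%:R + 1) / 2 :> R.
  rewrite ler_pdivlMr // natr1 -natrM ler_nat /h; have := uphalf_half k; have := odd_double_half k; lia.
have k14R : 14 <= k%:R :> R by rewrite ler_nat.
have mu_lb : m * (2 / 3) <= m * (1 - p) ^+ (n - h - 1) by apply: ler_wpM2l; rewrite // mE; lra.
have mu_ub : m * (1 - p) ^+ (n - h - 1) <= m by rewrite ler_piMr // mE; lra.
(* [2 / 3 * (k - 1) - (k + 1) / 2 >= k / 12] amounts to [k >= 14]. Chebyshev then gives
   [2 * k / (k / 12) ^ 2 = 288 / k]. *)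
have gap : k%:R / 12 <= m * (1 - p) ^+ (n - h - 1) - h%:R by rewrite mE in mu_lb *; lra.
have := @second_moment R n p p01 _ [pred i : 'I_n | (i < k - 1)%N] hub_cut (n - h - 1) 1 h%:R.
rewrite cI -/m => /(_ _ _ _ _ _)/le_trans; apply=> //.
- by move=> i _; exact: hub_cut_pairs.
- by move=> i ik; exact: card_hub_cut.
- move=> i j ik jk ij; have := cardsUI (hub_cut i) (hub_cut j).
  rewrite !card_hub_cut // mul2n -addnn => <-; rewrite leq_add2l.
  exact: card_cut_inter ij (@hub_cutP i) (@hub_cutP j).
- by move: kn k14; clear; lia.
- lra.
set mu := m * (1 - p) ^+ (n - h - 1) in mu_lb mu_ub gap *.
have num : mu + m ^+ 2 * (1 - p) ^+ (2 * (n - h - 1) - 1) * (1%:R * p) <= 2 * k%:R.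
  have mp : m * p <= 1.
    apply: le_trans (_ : n%:R * p <= _); first by apply: ler_wpM2r; rewrite // ler_nat; move: kn; clear; lia.
    apply: le_trans (ler_wpM2l (ltW n0) pn) _.
    have -> : n%:R * (1 / (3 * n%:R)) = 1 / 3 :> R by field; rewrite gt_eqF.
    lra.
  have qq : (1 - p) ^+ (2 * (n - h - 1) - 1) <= 1 by apply: exprn_ile1; lra.
  have qq0 : 0 <= (1 - p) ^+ (2 * (n - h - 1) - 1) by apply: exprn_ge0; lra.
  have m0 : 0 <= m by rewrite mE; lra.
  have : m ^+ 2 * (1 - p) ^+ (2 * (n - h - 1) - 1) * (1%:R * p) <= m.
    rewrite mul1r expr2 -!mulrA; apply: ler_piMr => //.
    rewrite mulrCA; apply: mulr_ile1 => //; exact: mulr_ge0.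
  by move=> le; apply: le_trans (lerD mu_ub le) _; rewrite mE; lra.
have kgt : 0 < k%:R :> R by rewrite ltr0n.
apply: le_trans (_ : 2 * k%:R / (k%:R / 12) ^+ 2 <= _); last first.
  by rewrite le_eqVlt; apply/orP; left; apply/eqP; field; rewrite gt_eqF.
apply: ler_pM => //.
- rewrite addr_ge0 // ?mulr_ge0 // ?exprn_ge0 ?sqr_ge0 //; lra.
- by rewrite invr_ge0 sqr_ge0.
- rewrite lef_pV2 ?posrE ?exprn_gt0 //; [|lra|lra].
  by apply: lerXn2r; rewrite ?nnegrE //; lra.
Qed.

End HubGraph.

Lemma not_hamiltonian_below_linear (R : realType) (k : nat -> nat) :
    ev (fun n => (2 * k n <= n)%N) ->
    (forall M : nat, ev (fun n => (M <= k n)%N)) ->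
    exists H : forall n : nat, graph n,
      (forall n, simple_graph (H n)) /\
      ev (fun n => alpha (H n) = k n /\ (k n <= 2 * mindeg (H n))%N) /\
      forall p : nat -> R,
        (forall n, 0 <= p n <= 1) ->
        ev (fun n => p n <= 1 / (3 * n%:R)) ->
        aas (fun n => prob_union (H n) (p n) (fun E => ~~ hamiltonian E)).
Proof.
move=> [N0 kn] kM.
have hub_lt n : (N0 <= n)%N -> (1 <= k n)%N -> (k n - 1 + uphalf (k n) < n)%N.
  by move=> /kn kn' k1; have := uphalf_half (k n); have := odd_double_half (k n); lia.
have [N1 k14] := kM 14%N.
exists (fun n => hub_graph n (k n)); split; last split.
- by move=> n; exact: rel_graph_simple.
- exists (maxn N0 N1) => n; rewrite geq_max => /andP[nN0 /k14 nk].
  have k1 : (0 < k n)%N by lia.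
  by split; [apply: hub_alpha|apply: hub_mindeg] => //; exact: hub_lt.
move=> p p01 [N2 pn]; apply: aas_of_le.
  by exists 0%N => n _; exact: prob_union_le1.
move=> eps eps0.
have [M HM] : exists M : nat, 288 / eps < M%:R.
  by exists (Num.truncn (288 / eps)).+1; exact: truncnS_gt.
have [N3 kbig] := kM M.
exists (maxn (maxn N0 N1) (maxn N2 N3)) => n.
rewrite !geq_max => /andP[/andP[n0 n1] /andP[n2 n3]].
have k14n := k14 n n1.
have k1 : (0 < k n)%N by lia.
apply: le_trans (hub_prob k1 (hub_lt n n0 k1) (p01 n) (pn n n2) k14n).
rewrite lerD2l lerN2 ler_pdivrMr ?ltr0n //.
have : 288 / eps <= (k n)%:R by apply: le_trans (ltW HM) _; rewrite ler_nat; exact: kbig.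
by rewrite ler_pdivrMr // mulrC.
Qed.

(** * Disjoint cliques *)

Section Cuts.
Variable n : nat.
Implicit Types (X Y : {set 'I_n}) (S : graph n).

Definition cut X Y : graph n := [set [set u.1; u.2] | u in setX X Y].

Lemma mem_cut X Y x y : x \in X -> y \in Y -> [set x; y] \in cut X Y.
Proof. by move=> xX yY; apply/imsetP; exists (x, y); rewrite // inE xX yY. Qed.

Lemma cut_pairs X Y : [disjoint X & Y] -> cut X Y \subset pairs n.
Proof.
move=> dXY; apply/subsetP => e /imsetP[[x y]]; rewrite inE => /andP[/= xX yY] ->.
rewrite inE cards2; case: (eqVneq x y) => [xy|//].
by have := disjointFr dXY xX; rewrite xy yY.
Qed.

Lemma card_cut X Y : [disjoint X & Y] -> #|cut X Y| = (#|X| * #|Y|)%N.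
Proof.
move=> dXY; rewrite card_in_imset ?cardsX // => -[x y] [x' y'].
rewrite !inE /= => /andP[xX yY] /andP[x'X y'Y] E.
have nXY u v : u \in X -> v \in Y -> (u == v) = false.
  by move=> uX vY; apply/eqP => uv; have := disjointFr dXY uX; rewrite uv vY.
have Ex : x = x'.
  by move/setP/(_ x): E; rewrite !inE eqxx (nXY x y') //= orbF => /esym/eqP.
have Ey : y = y'.
  by move/setP/(_ y): E; rewrite !inE eqxx orbT eq_sym (nXY x' y) //= => /esym/eqP.
by rewrite Ex Ey.
Qed.

Lemma cut_disjointP X Y S x y : [disjoint S & cut X Y] -> x \in X -> y \in Y -> ~~ adj S x y.
Proof.
move=> dis xX yY; rewrite /adj negb_and; apply/orP; right.
by rewrite (disjointFl dis) // mem_cut.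
Qed.

Lemma closed_not_hamiltonian E X x y : x \in X -> y \notin X ->
  (forall u v, u \in X -> adj E u v -> v \in X) -> ~~ hamiltonian E.
Proof.
move=> xX yX clX; apply/negP => /andP[n3 /existsP[C /andP[uqC cycC]]].
have memC := mem_full_tuple uqC.
have [i q Eq] := rot_to (memC x).
have pth : path (adj E) x q.
  by move: cycC; rewrite -(rot_cycle i) Eq /= rcons_path => /andP[].
have allX : all (mem X) (x :: q).
  rewrite /= xX /=; elim: q x xX {Eq} pth => //= z q IH x xX /andP[exz pth].
  by have zX := clX _ _ xX exz; rewrite zX (IH z).
by case/negP: yX; apply: (allP allX); rewrite -Eq mem_rot.
Qed.

End Cuts.

Section CliquesGraph.
Variables (n k m : nat).
Hypothesis m0 : (0 < m)%N.
Hypothesis mkn : (m.+1 * k.+1 <= n)%N.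

(* [m] blocks of [k + 1] vertices each, followed by one block with all other vertices. *)
Definition cliques_block (x : 'I_n) : nat := minn (x %/ k.+1) m.

Definition cliques_rel : rel 'I_n := fun x y => cliques_block x == cliques_block y.

Definition cliques_graph := rel_graph cliques_rel.

Lemma cliques_adj x y : adj cliques_graph x y = (x != y) && (cliques_block x == cliques_block y).
Proof. by rewrite rel_graphE // => u v; rewrite /cliques_rel eq_sym. Qed.

Definition cliques_class i : {set 'I_n} := [set x | cliques_block x == i].

Lemma card_cliques_class i : (i < m)%N -> #|cliques_class i| = k.+1.
Proof.
move=> im; have le : (i * k.+1 + k.+1 <= n)%N.
  by apply: leq_trans mkn; rewrite -mulSnr leq_mul2r; apply/orP; right; apply: leqW.
rewrite -(card_ord_itv le); congr #|pred_of_set _|; apply/setP => x; rewrite !inE /cliques_block.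
rewrite -leq_divRL // -mulSnr -ltn_divLR //.
by case: (leqP m (x %/ k.+1)); lia.
Qed.

Lemma card_cliques_class_ge (x : 'I_n) : (k.+1 <= #|cliques_class (cliques_block x)|)%N.
Proof.
have [lt|ge] := ltnP (cliques_block x) m; first by rewrite card_cliques_class.
have -> : cliques_block x = m by apply/eqP; rewrite eqn_leq ge geq_minr.
have le : (m * k.+1 + k.+1 <= n)%N by rewrite -mulSnr.
rewrite -{1}(card_ord_itv le); apply/subset_leq_card/subsetP => y; rewrite !inE /cliques_block.
by move=> /andP[my _]; apply/eqP/minn_idPr; rewrite leq_divRL.
Qed.

Lemma cliques_deg x : deg cliques_graph x = (#|cliques_class (cliques_block x)|).-1.
Proof.
rewrite (cardsD1 x) inE eqxx /=; congr #|pred_of_set _|; apply/setP => y.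
by rewrite !inE cliques_adj eq_sym [cliques_block x == _]eq_sym.
Qed.

Lemma cliques_mindeg : mindeg cliques_graph = k.
Proof.
have n0 : (0 < n)%N by lia.
apply/eqP; rewrite eqn_leq; apply/andP; split.
  apply: leq_trans (mindeg_le _ (Ordinal n0)) _.
  by rewrite cliques_deg /cliques_block /= div0n min0n card_cliques_class.
apply: mindeg_ge => [|x]; first by nia.
by rewrite cliques_deg; have := card_cliques_class_ge x; lia.
Qed.

Lemma cliques_alpha : (alpha cliques_graph <= m.+1)%N.
Proof.
apply: alpha_le => A /indepP iA.
pose f (x : 'I_n) : 'I_m.+1 := inord (cliques_block x).
rewrite -[X in (_ <= X)%N]card_ord -cardsT -(@card_in_imset _ _ f A).
  exact/subset_leq_card/subsetT.
move=> x y xA yA /(congr1 val); rewrite /f /= !inordK ?ltnS ?geq_minr // => E.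
apply/eqP; have := iA x y xA yA; rewrite cliques_adj E eqxx andbT; by case: eqP.
Qed.

Definition cliques_cut (i : 'I_m) := cut (cliques_class i) (~: cliques_class i).

Lemma cliques_cut_pairs i : cliques_cut i \subset pairs n.
Proof. by apply: cut_pairs; rewrite disjoints_subset setCK. Qed.

Lemma card_cliques_cut (i : 'I_m) : #|cliques_cut i| = (k.+1 * (n - k.+1))%N.
Proof.
rewrite card_cut; last by rewrite disjoints_subset setCK.
by rewrite [#|~: _|]cardsCs setCK card_cliques_class // card_ord.
Qed.

(** A pair that leaves both classes joins one to the other. *)
Lemma card_cliques_cutI (i j : 'I_m) : i != j -> (#|cliques_cut i :&: cliques_cut j| <= k.+1 ^ 2)%N.
Proof.
move=> ij.
have dij : [disjoint cliques_class i & cliques_class j].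
  rewrite -setI_eq0; apply/eqP/setP => x; rewrite !inE; apply/negbTE.
  by apply: contra ij => /andP[/eqP-> /eqP/val_inj->].
rewrite -mulnn -{1}(card_cliques_class (ltn_ord i)) -(card_cliques_class (ltn_ord j)) -card_cut //.
apply/subset_leq_card/subsetP => e /setIP[/imsetP[[x y]]]; rewrite !inE /=.
move=> /andP[xi yi] -> /imsetP[[x' y']]; rewrite !inE /= => /andP[x'j y'j] E.
have yx' : y = x'.
  have : x' \in [set x; y] by rewrite E !inE eqxx.
  rewrite !inE => /orP[/eqP x'x|/eqP//].
  by have := disjointFr dij (x := x); rewrite !inE xi -x'x x'j => /(_ isT).
by apply: mem_cut; rewrite inE // yx'.
Qed.

Lemma cliques_not_hamiltonian (S : graph n) (i : 'I_m) : [disjoint S & cliques_cut i] ->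
  ~~ hamiltonian (cliques_graph :|: S).
Proof.
move=> dis; have ci := card_cliques_class (ltn_ord i).
have [x xi] : exists x, x \in cliques_class i by apply/card_gt0P; rewrite ci.
have [y yi] : exists y, y \in ~: cliques_class i.
  apply/card_gt0P; rewrite cardsCs setCK ci card_ord subn_gt0.
  apply: leq_trans mkn; rewrite -[X in (X < _)%N]mul1n ltn_mul2r /=; lia.
apply: (closed_not_hamiltonian xi (y := y)); first by rewrite inE in yi.
move=> u v ui; rewrite adjU => /orP[|].
  by rewrite cliques_adj => /andP[_ /eqP E]; move: ui; rewrite !inE E.
by move=> euv; apply: contraLR euv => nv; apply: cut_disjointP dis ui _; rewrite inE.
Qed.

(* To be used with [L = ln n] and [z = n ^ (eps / 2)]. *)
Lemma cliques_prob (R : realType) (p z c eps L : R) :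
  0 <= p <= 1 -> 0 < eps -> (0 < k)%N ->
  2 <= z -> 0 < c -> c * z ^+ 2 / 8 <= m%:R -> k%:R * z ^+ 2 <= n%:R ->
  L <= 2 / eps * z -> expR (- (eps / 2 * L)) = z^-1 ->
  p <= eps / 8 * L / (n%:R * k%:R) ->
  1 - (8 / c + 2) / z <= prob_union cliques_graph p (fun E => ~~ hamiltonian E).
Proof.
move=> p01 eps0 k0 z2 c0 mz kz Lz Ez pk; have [p0 p1] := andP p01.
pose X (S : graph n) : R := \sum_(i : 'I_m) ([disjoint S & cliques_cut i])%:R.
apply: le_trans (@prob_union_ge R n cliques_graph p _ (fun S => ((X S <= 0)%R)%:R) p01 _); last first.
  move=> S _; have [i disi|none] := pickP (fun i : 'I_m => [disjoint S & cliques_cut i]).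
    by rewrite (cliques_not_hamiltonian disi) lerBlDr lerDl ler0n.
  rewrite /X big1 ?lexx ?subrr ?ler0n // => i _; by rewrite none.
rewrite lerD2l lerN2.
have n2k : (2 * k.+1 <= n)%N by apply: leq_trans mkn; rewrite leq_mul2r ltnS m0.
set b := (k.+1 * (n - k.+1))%N; set r := (k.+1 ^ 2)%N.
have n0 : 0 < n%:R :> R by rewrite ltr0n; apply: leq_trans n2k.
have kR0 : 0 < k%:R :> R by rewrite ltr0n.
have z0 : 0 < z by lra.
have k2 : k.+1%:R <= 2 * k%:R :> R by rewrite -natrM ler_nat; move: k0; clear; lia.
have pnk : p * (n%:R * k%:R) <= eps / 8 * L by rewrite -ler_pdivlMr // mulr_gt0.
(* The correlations are small: [k ^ 2 * p * z ^ 2 <= p * n * k <= eps / 8 * L <= z / 4], and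
   [r <= 4 * k ^ 2]. *)
have rp : r%:R * p <= z^-1.
  have rk : r%:R <= 4 * k%:R ^+ 2 :> R.
    rewrite /r natrX; apply: le_trans (_ : (2 * k%:R) ^+ 2 <= _); last by rewrite exprMn; lra.
    by apply: lerXn2r; rewrite ?nnegrE ?ler0n // mulr_ge0 ?ler0n.
  rewrite -[leRHS]mul1r ler_pdivlMr //.
  apply: le_trans (_ : 4 * k%:R ^+ 2 * p * z <= _).
    by apply: ler_wpM2r; [lra|exact: ler_wpM2r].
  have h1 : p * (n%:R * k%:R) <= z / 4.
    apply: le_trans pnk _; apply: le_trans (_ : eps / 8 * (2 / eps * z) <= _).
      by apply: ler_wpM2l => //; lra.
    by rewrite le_eqVlt; apply/orP; left; apply/eqP; field; rewrite gt_eqF.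
  have h2 : k%:R ^+ 2 * p * z ^+ 2 <= z / 4.
    apply: le_trans h1.
    have -> : k%:R ^+ 2 * p * z ^+ 2 = (p * k%:R) * (k%:R * z ^+ 2) by ring.
    have -> : p * (n%:R * k%:R) = (p * k%:R) * n%:R by ring.
    by apply: ler_wpM2l kz; apply: mulr_ge0 => //; exact: ltW.
  have h3 : (4 * k%:R ^+ 2 * p * z) * z <= 1 * z.
    have -> : 4 * k%:R ^+ 2 * p * z * z = 4 * (k%:R ^+ 2 * p * z ^+ 2) by ring.
    lra.
  by rewrite -(ler_pM2r z0).
have zV : z^-1 <= 1 / 2 by rewrite div1r lef_pV2 ?posrE.
have r1 : 1 <= r%:R :> R by rewrite ler1n /r expn_gt0.
have pr : p <= r%:R * p by rewrite ler_peMl.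
have p12 : p <= 1 / 2 by lra.
have q0 : 0 < 1 - p by lra.
(* A clique is isolated with probability at least [1 / z], since [1 - p >= expR (- (2 * p))] for
   [p <= 1 / 2] and [2 * p * b <= 4 * p * n * k <= eps / 2 * L]. This fixes the constant
   [eps / 8]. *)
have qb : z^-1 <= (1 - p) ^+ b.
  have qexp : expR (- (2 * p)) <= 1 - p.
    rewrite expRN -[leRHS]invrK lef_pV2 ?posrE ?expR_gt0 ?invr_gt0 //.
    apply: le_trans (expR_ge1Dx _); rewrite -[leLHS]mul1r ler_pdivrMr //.
    have : 0 <= p * (1 - 2 * p) by apply: mulr_ge0 => //; lra.
    by nra.
  apply: le_trans (_ : expR (- (2 * p)) ^+ b <= _); last first.
    by apply: lerXn2r; rewrite ?nnegrE ?expR_ge0 // ltW.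
  rewrite -Ez -expRM_natl ler_expR mulrN lerN2.
  have bk : b%:R <= n%:R * (2 * k%:R) :> R.
    apply: le_trans (_ : n%:R * k.+1%:R <= _); last by apply: ler_wpM2l => //; exact: ltW.
    by rewrite -natrM ler_nat /b mulnC leq_mul2r leq_subr orbT.
  apply: le_trans (_ : n%:R * (2 * k%:R) * (2 * p) <= _).
    by apply: ler_wpM2r => //; lra.
  have -> : n%:R * (2 * k%:R) * (2 * p) = 4 * (p * (n%:R * k%:R)) by ring.
  by lra.
have mR : 0 < m%:R :> R by rewrite ltr0n.
have mu0 : 0 < m%:R * (1 - p) ^+ b by rewrite mulr_gt0 // exprn_gt0.
have r2b : (r <= 2 * b)%N.
  rewrite /r /b -mulnn mulnCA leq_mul2l /=; move: n2k; clear; lia.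
have := @second_moment R n p p01 _ predT cliques_cut b r 0.
cbv zeta; rewrite card_ord subr0 => /(_ _ _ _ _ _)/le_trans; apply=> //.
- by move=> i _; exact: cliques_cut_pairs.
- by move=> i _; exact: card_cliques_cut.
- move=> i j _ _ ij; have := cardsUI (cliques_cut i) (cliques_cut j).
  rewrite !card_cliques_cut mul2n -addnn => <-; rewrite leq_add2l.
  exact: card_cliques_cutI.
set mu := m%:R * (1 - p) ^+ b in mu0 *.
have muz : c / 8 * z <= mu.
  apply: le_trans (_ : (c * z ^+ 2 / 8) * z^-1 <= _); last first.
    by apply: ler_pM => //; rewrite ?invr_ge0 ?ltW // !mulr_gt0 // exprn_gt0.
  by rewrite le_eqVlt; apply/orP; left; apply/eqP; field; rewrite gt_eqF.
have bern := bernoulli r p01.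
have m2 : m%:R ^+ 2 * (1 - p) ^+ (2 * b - r) <= 2 * mu ^+ 2.
  have E : m%:R ^+ 2 * (1 - p) ^+ (2 * b - r) * (1 - p) ^+ r = mu ^+ 2.
    by rewrite -mulrA -exprD subnK // /mu exprMn -exprM (mulnC b 2).
  have qr : 1 / 2 <= (1 - p) ^+ r by lra.
  have : 0 <= m%:R ^+ 2 * (1 - p) ^+ (2 * b - r).
    by rewrite mulr_ge0 ?sqr_ge0 // exprn_ge0 // ltW.
  rewrite -E; set Y := _ * _; set W := _ ^+ r in qr *; nra.
have mu2 : 0 < mu ^+ 2 by rewrite exprn_gt0.
rewrite ler_pdivrMr //.
apply: le_trans (_ : mu + 2 * mu ^+ 2 * z^-1 <= _).
  rewrite lerD2l; apply: ler_pM => //.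
  - by rewrite mulr_ge0 ?sqr_ge0 // exprn_ge0 // ltW.
  - by rewrite mulr_ge0 ?ler0n.
(* The first term absorbs the variance part [mu], as [mu >= c / 8 * z]; the second is the
   correlation part. *)
have -> : (8 / c + 2) / z * mu ^+ 2 = 8 / (c * z) * mu ^+ 2 + 2 * mu ^+ 2 * z^-1.
  by field; rewrite !gt_eqF.
rewrite lerD2r expr2 mulrA; apply: ler_peMl; first exact: ltW.
rewrite mulrAC ler_pdivlMr ?mulr_gt0 // mul1r.
lra.
Qed.

End CliquesGraph.

Lemma ev_powR_ge (R : realType) (s M : R) : 0 < s -> ev (fun n => M <= n%:R `^ s).
Proof.
move=> s0; exists (Num.truncn (Num.max M 0 `^ s^-1)).+1 => n Nn.
have M0 : 0 <= Num.max M 0 by rewrite le_max lexx orbT.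
apply: le_trans (_ : Num.max M 0 <= _); first by rewrite le_max lexx.
have E : Num.max M 0 = (Num.max M 0 `^ s^-1) `^ s.
  by rewrite -powRrM mulVf ?lt0r_neq0 // powRr1.
rewrite {1}E; apply: ge0_ler_powR; rewrite ?nnegrE ?powR_ge0 ?ler0n //; first exact: ltW.
by apply: ltW; apply: lt_le_trans (truncnS_gt _) _; rewrite ler_nat.
Qed.

Lemma not_hamiltonian_below_log (R : realType) (eps c : R) : 0 < eps < 1 / 2 -> 0 < c < 1 ->
    forall k : nat -> nat,
      ev (fun n => n%:R `^ eps <= (k n)%:R <= n%:R `^ (1 - eps)) ->
      exists c' : R, 0 < c' /\
      exists H : forall n : nat, graph n,
        (forall n, simple_graph (H n)) /\
        ev (fun n => mindeg (H n) = k n /\ (alpha (H n))%:R <= c * (k n)%:R) /\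
        forall p : nat -> R,
          (forall n, 0 <= p n <= 1) ->
          ev (fun n => p n <= c' * ln (n%:R) / (n%:R * (k n)%:R)) ->
          aas (fun n => prob_union (H n) (p n) (fun E => ~~ hamiltonian E)).
Proof.
move=> /andP[eps0 eps1] /andP[c0 c1] k [N0 kn].
exists (eps / 8); split; first by rewrite divr_gt0.
pose z n : R := n%:R `^ (eps / 2).
(* As [z n ^+ 2] is [n ^ eps], this is few enough for [m + 1 <= c * k] and for the cliques to fit
   into [n] vertices, while [m] times the isolation probability [1 / z] still tends to infinity. *)
pose m n := Num.truncn (c * z n ^+ 2 / 4).
have [N1 zbig] := @ev_powR_ge R (eps / 2) (8 / c) (divr_gt0 eps0 (ltr0n _ 2)).
have facts n : (maxn N0 N1 <= n)%N ->
    [/\ 8 <= z n, z n ^+ 2 <= (k n)%:R, (k n)%:R * z n ^+ 2 <= n%:R,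
        c * z n ^+ 2 / 8 <= (m n)%:R & ((m n).+1 * (k n).+1 <= n)%N] /\
    [/\ (0 < m n)%N, (0 < k n)%N, (m n).+1%:R <= c * (k n)%:R, 0 < n%:R :> R &
        8 / c <= z n].
  rewrite geq_max => /andP[/kn/andP[k1 k2] /zbig z1].
  have z8 : 8 <= z n.
    by apply: le_trans z1; rewrite ler_pdivlMr // ler_piMr //; exact: ltW.
  have z0 : 0 < z n by lra.
  have n0 : 0 < n%:R :> R.
    rewrite lt0r ler0n andbT; apply/eqP => n0; move: z8.
    by rewrite /z n0 powR0 ?gt_eqF ?divr_gt0 //; lra.
  have zz : z n ^+ 2 = n%:R `^ eps.
    by rewrite -powR_mulrn ?powR_ge0 // -powRrM divfK ?gt_eqF.
  have kz : (k n)%:R * z n ^+ 2 <= n%:R.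
    have -> : n%:R = n%:R `^ (1 - eps) * n%:R `^ eps :> R.
      rewrite -powRD; last by rewrite subrK oner_eq0.
      by rewrite subrK powRr1 ?ler0n.
    by rewrite zz; apply: ler_wpM2r k2; exact: powR_ge0.
  have cz : 8 <= c * z n by move: z1; rewrite ler_pdivrMr // mulrC.
  have czz : 64 <= c * z n ^+ 2.
    rewrite expr2 mulrA; apply: le_trans (_ : 8 * 8 <= _); first lra.
    by apply: ler_pM => //; lra.
  have cz0 : 0 <= c * z n ^+ 2 / 4 by lra.
  have mle : (m n)%:R <= c * z n ^+ 2 / 4 by rewrite truncn_le.
  have mgt : c * z n ^+ 2 / 4 < (m n).+1%:R by exact: truncnS_gt.
  have kzz : z n ^+ 2 <= (k n)%:R by rewrite zz.
  have czk : c * z n ^+ 2 <= c * (k n)%:R by apply: ler_wpM2l => //; exact: ltW.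
  have mS : (m n).+1%:R = (m n)%:R + 1 :> R by rewrite -natr1.
  have m0 : (0 < m n)%N by rewrite -(ltr0n R); lra.
  have z64 : 64 <= z n ^+ 2.
    by apply: le_trans czz _; rewrite ler_piMl ?sqr_ge0 // ltW.
  have k64 : 64 <= (k n)%:R :> R by lra.
  have k0 : (0 < k n)%N by rewrite -(ltr0n R); lra.
  split; split=> //; try lra.
  rewrite -(ler_nat R) natrM; apply: le_trans kz.
  have m4 : (m n).+1%:R <= z n ^+ 2 / 2.
    have : c * z n ^+ 2 <= z n ^+ 2 by rewrite ler_piMl ?sqr_ge0 // ltW.
    by lra.
  have k2' : (k n).+1%:R <= 2 * (k n)%:R :> R by rewrite -natr1; lra.
  have -> : (k n)%:R * z n ^+ 2 = (z n ^+ 2 / 2) * (2 * (k n)%:R) by field.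
  by apply: ler_pM; rewrite ?ler0n.
exists (fun n => cliques_graph n (k n) (m n)); split; last split.
- by move=> n; exact: rel_graph_simple.
- exists (maxn N0 N1) => n /facts[[_ _ _ _ mkn] [m0 k0 mk _ _]]; split.
    exact: cliques_mindeg.
  by apply: le_trans mk; rewrite ler_nat; exact: cliques_alpha.
move=> p p01 [N2 pn]; apply: aas_of_le.
  by exists 0%N => n _; exact: prob_union_le1.
move=> d d0.
have [N3 zd] := @ev_powR_ge R (eps / 2) ((8 / c + 2) / d) (divr_gt0 eps0 (ltr0n _ 2)).
exists (maxn (maxn N0 N1) (maxn N2 N3)) => n.
rewrite geq_max => /andP[/facts[[z8 _ kz mz mkn] [m0 k0 _ n0 _]]].
rewrite geq_max => /andP[/pn pnn /zd zdn].
have z0 : 0 < z n by lra.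
have zE : z n = expR (eps / 2 * ln n%:R) by rewrite /z /powR gt_eqF.
have z2 : 2 <= z n by lra.
have Lz : ln n%:R <= 2 / eps * z n.
  have le : eps / 2 * ln n%:R <= z n by rewrite zE; apply: le_trans (expR_ge1Dx _); lra.
  have -> : ln n%:R = 2 / eps * (eps / 2 * ln n%:R) by field; rewrite gt_eqF.
  by apply: ler_wpM2l => //; rewrite divr_ge0 // ltW.
have Ez : expR (- (eps / 2 * ln n%:R)) = (z n)^-1 by rewrite expRN -zE.
apply: le_trans (cliques_prob m0 mkn (p01 n) eps0 k0 z2 c0 mz kz Lz Ez pnn).
by rewrite lerD2l lerN2 ler_pdivrMr // (mulrC d) -ler_pdivrMr.
Qed.

(** * Toughness of the union *)

Section Toughness.
Variables (n : nat) (G Rg : graph n) (A : {set 'I_n}).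
Local Notation e := (del_rel G A).
Local Notation e' := (del_rel (G :|: Rg) A).

Lemma del_rel_sym (E : graph n) : symmetric (del_rel E A).
Proof. by move=> x y; rewrite /del_rel adj_sym [(x \notin A) && _]andbC. Qed.

Lemma del_rel_root (E : graph n) x y :
  del_rel E A x y -> root (del_rel E A) x = root (del_rel E A) y.
Proof.
move=> exy; apply/(rootP (sym_connect_sym (del_rel_sym E))); exact: connect1.
Qed.

Lemma root_notin (E : graph n) x : x \notin A -> root (del_rel E A) x \notin A.
Proof.
have cl : closed (del_rel E A) (~: A).
  by move=> u v /and3P[_ uA vA]; rewrite !in_setC uA vA.
by move=> xA; have := closed_connect cl (connect_root _ x); rewrite !in_setC xA => <-.
Qed.

(* Components are encoded by their roots: this is what the union bound ranges over. *)
Definition comp_union (Q : {set 'I_n}) : {set 'I_n} :=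
  [set y | (y \notin A) && (root e y \in Q)].

Lemma ncomp_root_set (E : graph n) :
  ncomp E A = #|[set y in ~: A | root (del_rel E A) y == y]|.
Proof.
rewrite cardsE; apply: eq_card => y; rewrite !inE [RHS](andbC (y \in ~: A)) in_setC.
by [].
Qed.

Lemma ncomp_le_alpha (E : graph n) : (ncomp E A <= alpha E)%N.
Proof.
rewrite ncomp_root_set; apply: indep_le_alpha; apply/indepP => x y.
rewrite !inE => /andP[xA /eqP rx] /andP[yA /eqP ry]; apply/negP => exy.
have := @del_rel_root E x y; rewrite /del_rel exy xA yA rx ry => /(_ isT) xy.
by move: exy; rewrite xy adj_irr.
Qed.

(** [X] is a union of components of the union graph without [A], hence also of components of [G]
    without [A], whose roots form [Q]; thus [comp_union Q] describes [X] without reference to random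
    edges. A component of the latter kind contains all neighbours outside [A] of any of its
    vertices, so it has at least [k / 2] vertices. *)
Lemma component_separation k (B : {set 'I_n}) (X := [set y | (y \notin A) && (root e' y \in B)]) :
  B \subset [set y in ~: A | root e' y == y] -> (k <= mindeg G)%N -> (2 * #|A| <= k)%N ->
  exists Q, [/\ comp_union Q = X, (#|B| <= #|Q|)%N, (k * #|Q| <= 2 * #|X|)%N &
    [disjoint Rg & cut X (~: (A :|: X))]].
Proof.
move=> BR kG Ak.
have sub_e x y : e x y -> e' x y by rewrite /del_rel adjU => /and3P[-> -> ->].
have root_e x y : root e x = root e y -> root e' x = root e' y.
  move/(rootP (sym_connect_sym (del_rel_sym G))) => cxy.
  apply/(rootP (sym_connect_sym (del_rel_sym _))).
  by apply: connect_sub cxy => u v /sub_e; exact: connect1.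
exists [set root e y | y in X]; split.
- apply/setP => y; rewrite !inE; case yA: (y \in A) => //=.
  apply/imsetP/idP => [[z]|yB]; last by exists y; rewrite // inE yA.
  by rewrite inE => /andP[zA zB] /root_e->.
- rewrite -(card_in_imset (f := root e) (D := B)).
    apply/subset_leq_card/subsetP => z /imsetP[b bB ->]; apply: imset_f.
    have := subsetP BR _ bB; rewrite !inE => /andP[-> /eqP->] //=.
  move=> b b' /(subsetP BR); rewrite !inE => /andP[_ /eqP rb] /(subsetP BR).
  by rewrite !inE => /andP[_ /eqP rb'] /root_e; rewrite rb rb'.
- set Q := [set root e y | y in X].
  rewrite -[#|X|]sum1_card (partition_big (root e) (mem Q)) /=; last first.
    by move=> y yX; exact: imset_f.
  rewrite big_distrr /= mulnC -sum_nat_const; apply: leq_sum => q /imsetP[y yX ->].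
  rewrite sum1dep_card.
  have [yA yB] : y \notin A /\ root e' y \in B by move: yX; rewrite inE => /andP[].
  have : (#|[set z | adj G y z] :\: A| <= #|[set z in X | root e z == root e y]|)%N.
    apply/subset_leq_card/subsetP => z; rewrite !inE => /andP[zA yz].
    have ez : e y z by rewrite /del_rel yz yA.
    by rewrite zA /= -(del_rel_root (sub_e _ _ ez)) yB (del_rel_root ez) eqxx.
  have := leq_trans kG (mindeg_le G y).
  have := cardsD [set z | adj G y z] A.
  have := subset_leq_card (subsetIr [set z | adj G y z] A).
  rewrite /deg; set d1 := #|_ :&: _|; set d2 := #|_ :\: _|; set d3 := #|[set z | adj G y z]|.
  set d4 := #|[set _ in _ | _]|; move: Ak; set d5 := #|A|; clear; lia.
- apply/pred0P => f /=; apply/negbTE/negP => /andP[fR /imsetP[[x y]]].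
  rewrite !inE /= negb_or => /andP[/andP[xA xB] /andP[yA yX]] Ef.
  have exy : e' x y.
    rewrite /del_rel adjU xA yA /= andbT; apply/orP; right; rewrite /adj -Ef fR andbT.
    by apply: contraNneq yX => <-; rewrite xA.
  by move: yX; rewrite yA -(del_rel_root exy) xB.
Qed.

(** Split the [c >= 2] components into two halves, each with at least [c / 3] of them, and keep one
    that covers at most half of the vertices outside [A]. Since [#|A| <= k / 2 < n / 2], at least
    [n / 4] vertices remain outside it and [A]. *)
Lemma separation k : (1 < ncomp (G :|: Rg) A)%N -> (k <= mindeg G)%N ->
  (2 * #|A| <= k)%N -> (k < n)%N ->
  exists Q, let X := comp_union Q in
    [/\ (ncomp (G :|: Rg) A <= 3 * #|Q|)%N, (k * #|Q| <= 2 * #|X|)%N,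
      (n <= 4 * #|~: (A :|: X)|)%N & [disjoint Rg & cut X (~: (A :|: X))]].
Proof.
move=> c1 kG Ak kn; rewrite ncomp_root_set in c1 *.
set Rt := [set y in ~: A | _] in c1 *.
pose X (B : {set 'I_n}) := [set y | (y \notin A) && (root e' y \in B)].
pose A1 : {set 'I_n} := [set x in take (#|Rt|./2) (enum Rt)].
have A1R : A1 \subset Rt.
  by apply/subsetP => x; rewrite inE => /mem_take; rewrite mem_enum.
have cA1 : #|A1| = #|Rt|./2.
  rewrite cardsE; have /card_uniqP -> : uniq (take (#|Rt|./2) (enum Rt)).
    exact/take_uniq/enum_uniq.
  by rewrite size_takel // -cardE; have := odd_double_half #|Rt|; clear; move: #|Rt| => u; lia.
have cA2 : #|Rt :\: A1| = (#|Rt| - #|Rt|./2)%N by rewrite cardsD (setIidPr A1R) cA1.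
have X12 : (#|X A1| + #|X (Rt :\: A1)| = n - #|A|)%N.
  have := cardsUI (X A1) (X (Rt :\: A1)).
  have -> : X A1 :&: X (Rt :\: A1) = set0.
    by apply/setP => y; rewrite !inE; case: (_ \in take _ _); rewrite ?andbF.
  have -> : X A1 :|: X (Rt :\: A1) = ~: A.
    apply/setP => y; rewrite !inE -andb_orr; case yA: (y \in A) => //=.
    rewrite root_notin ?yA // (root_root (sym_connect_sym (del_rel_sym _))) eqxx andbT.
    by case: (_ \in take _ _).
  by rewrite cards0 addn0 => <-; rewrite cardsCs setCK card_ord.
have An : (#|A| <= n)%N by rewrite -[X in (_ <= X)%N]card_ord max_card.
have cY B : #|~: (A :|: X B)| = (n - #|A| - #|X B|)%N.
  rewrite cardsCs setCK card_ord cardsU.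
  have -> : A :&: X B = set0 by apply/setP => y; rewrite !inE; case: (y \in A).
  by rewrite cards0 subn0 subnDA.
have key (B : {set 'I_n}) : B \subset Rt -> (#|Rt| <= 3 * #|B|)%N -> (2 * #|X B| <= n - #|A|)%N ->
  exists Q, let X := comp_union Q in
    [/\ (#|Rt| <= 3 * #|Q|)%N, (k * #|Q| <= 2 * #|X|)%N,
      (n <= 4 * #|~: (A :|: X)|)%N & [disjoint Rg & cut X (~: (A :|: X))]].
  move=> BR cB XB; have [Q [EQ BQ kQ dis]] := component_separation BR kG Ak.
  exists Q => /=; rewrite EQ; split=> //; first by apply: leq_trans cB _; rewrite leq_mul2l.
  by rewrite cY; move: XB Ak kn An; clear; move: #|A| #|X B| => u v; lia.
have [le|gt] := leqP (2 * #|X A1|) (n - #|A|).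
  apply: (key A1) => //; rewrite cA1; have := odd_double_half #|Rt|.
  by move: c1; clear; move: #|Rt| => u; lia.
apply: (key (Rt :\: A1)); first exact: subsetDl.
  by rewrite cA2; have := odd_double_half #|Rt|; move: c1; clear; move: #|Rt| => u; lia.
by move: gt X12; clear; move: #|X A1| #|X (Rt :\: A1)| #|A| => u v w; lia.
Qed.

End Toughness.

(** * The union bound for toughness *)

Section ToughUnion.
Variables (R : realType) (n : nat) (G : graph n) (t0 : R).
Hypothesis t1 : 1 <= t0.
Hypothesis at0 : 2 * t0 * (alpha G)%:R <= (mindeg G)%:R.

Definition bad_cut (A Q : {set 'I_n}) : bool :=
  let X := comp_union G A Q in
  [&& (0 < #|Q|)%N, #|A|%:R <= 3 * t0 * #|Q|%:R, (mindeg G * #|Q| <= 2 * #|X|)%N &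
      (n <= 4 * #|~: (A :|: X)|)%N].

Definition cut_of (A Q : {set 'I_n}) : graph n :=
  let X := comp_union G A Q in cut X (~: (A :|: X)).

Lemma tough_of_no_cut (S : graph n) :
  (forall A Q, bad_cut A Q -> ~~ [disjoint S & cut_of A Q]) -> tough (G :|: S) t0.
Proof.
move=> none A; rewrite leNgt; apply/negP; rewrite gt_max => /andP[c1 cA].
have t00 : 0 < t0 := lt_le_trans ltr01 t1.
rewrite ltr1n in c1; rewrite ltr_pdivrMr // in cA.
have calpha := leq_trans (ncomp_le_alpha A (G :|: S)) (alphaU G S).
(* With [c] components, [#|A| < t0 * c <= t0 * alpha G <= mindeg G / 2]. *)
have Ak : (2 * #|A| <= mindeg G)%N.
  rewrite -(ler_nat R) natrM.
  have : (ncomp (G :|: S) A)%:R * t0 <= (alpha G)%:R * t0 by rewrite ler_pM2r // ler_nat.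
  by move: at0 cA; lra.
have [x _] : exists x : 'I_n, x \in ~: A.
  have := ltnW c1; rewrite ncomp_root_set => /card_gt0P[x]; rewrite inE => /andP[xA _].
  by exists x.
have kn : (mindeg G < n)%N by apply: leq_ltn_trans (mindeg_le G x) (deg_lt G x).
have [Q [cQ kQ nY dis]] := separation c1 (leqnn _) Ak kn.
have := none A Q; rewrite /cut_of dis => /(_ _)/negP; apply=> //.
rewrite /bad_cut kQ nY !andbT; apply/andP; split; first lia.
apply: ltW; apply: lt_le_trans cA _.
have : (ncomp (G :|: S) A)%:R <= 3 * #|Q|%:R :> R by rewrite -natrM ler_nat.
by rewrite -(ler_pM2r t00); lra.
Qed.

Lemma sum_exp_card (x : R) : \sum_(A : {set 'I_n}) x ^+ #|A| = (1 + x) ^+ n.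
Proof.
transitivity (\prod_(i : 'I_n) (x + 1)); last by rewrite prodr_const card_ord addrC.
rewrite bigA_distr; apply: eq_bigr => A _.
by rewrite -prodr_const [LHS]big_mkcond.
Qed.

(** With [k = mindeg G], a bad cut has at least [k * #|Q| * n / 8] pairs, so it is avoided with
    probability at most [expR (- ((3 * t0 + 2) * #|Q| * ln n))]. As [#|A| <= 3 * t0 * #|Q|] and
    [1 <= #|Q|], this is at most [n ^ -(#|A| + #|Q| + 1)]. Summing over all pairs of sets gives
    [(1 + 1 / n) ^ (2 * n) / n]. *)
Lemma prob_bad_cut (p : R) : (0 < n)%N -> (0 < mindeg G)%N -> 0 <= p <= 1 ->
  8 * (3 * t0 + 2) * ln n%:R / (n%:R * (mindeg G)%:R) <= p ->
  expect p (fun S => \sum_(u : {set 'I_n} * {set 'I_n} | bad_cut u.1 u.2)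
     ([disjoint S & cut_of u.1 u.2])%:R) <= expR 1 ^+ 2 / n%:R.
Proof.
move=> n0 k0 p01 pk; have [p0 p1] := andP p01.
have nR : 0 < n%:R :> R by rewrite ltr0n.
have kR : 0 < (mindeg G)%:R :> R by rewrite ltr0n.
have L0 : 0 <= ln n%:R :> R by rewrite ln_ge0 // ler1n.
rewrite expect_sum.
apply: le_trans (_ : \sum_(u : {set 'I_n} * {set 'I_n})
  n%:R^-1 * (n%:R^-1 ^+ #|u.1| * n%:R^-1 ^+ #|u.2|) <= _).
  rewrite [leRHS](bigID (fun u => bad_cut u.1 u.2)) /= -[leLHS]addr0; apply: lerD; last first.
    by apply: sumr_ge0 => u _; rewrite !mulr_ge0 ?exprn_ge0 ?invr_ge0 ?ler0n.
  apply: ler_sum => -[A Q] /= /and4P[Q0 AQ kX nY].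
  have disXY : [disjoint comp_union G A Q & ~: (A :|: comp_union G A Q)].
    by rewrite disjoints_subset setCK subsetUr.
  rewrite expect_avoid; last exact: cut_pairs.
  rewrite card_cut //; set X := comp_union G A Q in kX nY *; set Y := ~: _ in nY *.
  apply: le_trans (_ : expR (- p) ^+ (#|X| * #|Y|) <= _).
    apply: lerXn2r; rewrite ?nnegrE ?expR_ge0 ?subr_ge0 //.
    exact: expR_ge1Dx.
  have -> : n%:R^-1 * (n%:R^-1 ^+ #|A| * n%:R^-1 ^+ #|Q|) = expR (- ((#|A|%:R + #|Q|%:R + 1) * ln n%:R)) :> R.
    rewrite -exprD -exprS exprVn expRN -[X in X ^+ _](lnK (x := n%:R)) ?posrE // -expRM_natl.
    by rewrite -addn1 !natrD.
  rewrite -expRM_natl ler_expR mulrN lerN2 natrM.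
  have kXR : (mindeg G)%:R * #|Q|%:R <= 2 * #|X|%:R :> R by rewrite -!natrM ler_nat.
  have nYR : n%:R <= 4 * #|Y|%:R :> R by rewrite -natrM ler_nat.
  have Q1 : 1 <= #|Q|%:R :> R by rewrite ler1n.
  have XY : (mindeg G)%:R * #|Q|%:R * n%:R <= 8 * (#|X|%:R * #|Y|%:R) :> R.
    apply: le_trans (_ : (2 * #|X|%:R) * (4 * #|Y|%:R) <= _); last lra.
    by apply: ler_pM => //; rewrite ?mulr_ge0 ?ler0n.
  apply: le_trans (_ : (mindeg G)%:R * #|Q|%:R * n%:R / 8 * p <= _); last first.
    by apply: ler_wpM2r => //; lra.
  apply: le_trans (_ : (3 * t0 + 2) * #|Q|%:R * ln n%:R <= _).
    by apply: ler_wpM2r => //; lra.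
  apply: le_trans (_ : (mindeg G)%:R * #|Q|%:R * n%:R / 8 *
     (8 * (3 * t0 + 2) * ln n%:R / (n%:R * (mindeg G)%:R)) <= _); last first.
    by apply: ler_wpM2l => //; rewrite !mulr_ge0 ?ler0n.
  by rewrite le_eqVlt; apply/orP; left; apply/eqP; field; rewrite !gt_eqF.
rewrite -(pair_bigA _ (fun A Q : {set 'I_n} => n%:R^-1 * (n%:R^-1 ^+ #|A| * n%:R^-1 ^+ #|Q|))) /=.
have -> : \sum_(A : {set 'I_n}) \sum_(Q : {set 'I_n}) n%:R^-1 * (n%:R^-1 ^+ #|A| * n%:R^-1 ^+ #|Q|)
    = (1 + n%:R^-1) ^+ n ^+ 2 / n%:R :> R.
  rewrite -sum_exp_card mulrC expr2 big_distrlr /= big_distrr; apply: eq_bigr => A _ /=.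
  by rewrite big_distrr.
apply: ler_wpM2r; first by rewrite invr_ge0 ltW.
have q0 : 0 <= 1 + n%:R^-1 :> R by rewrite addr_ge0 // invr_ge0 ltW.
apply: lerXn2r; rewrite ?nnegrE ?expR_ge0 ?exprn_ge0 //.
apply: le_trans (_ : expR (n%:R^-1) ^+ n <= _).
  by apply: lerXn2r; rewrite ?nnegrE ?expR_ge0 //; exact: expR_ge1Dx.
by rewrite -expRM_natl mulfV // gt_eqF.
Qed.

End ToughUnion.

Lemma pancyclic_above_log (R : realType) (t0 : R) : 1 <= t0 ->
    (forall (n : nat) (E : graph n), simple_graph E -> (3 <= n)%N ->
        tough E t0 -> hamiltonian E) ->
    exists c1 c2 : R, 0 < c1 /\ 0 < c2 /\
      forall (G : forall n : nat, graph n) (k : nat -> nat) (p : nat -> R),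
        (forall n, simple_graph (G n)) ->
        (forall n, 0 <= p n <= 1) ->
        ev (fun n => mindeg (G n) = k n) ->
        ev (fun n => (alpha (G n))%:R <= c2 * (k n)%:R) ->
        ev (fun n => c1 * ln (n%:R) / (n%:R * (k n)%:R) <= p n) ->
        aas (fun n => prob_union (G n) (p n) (@pancyclic n)).
Proof.
(* The second constant serves twice: it yields [2 * t0 * alpha <= k] for toughness and
   [1000 * alpha <= k] for pancyclicity. *)
move=> t1 toughH; exists (8 * (3 * t0 + 2)), (1000 * t0)^-1.
have t00 : 0 < t0 by lra.
have tt0 : 0 < 1000 * t0 by lra.
split; first lra; split; first by rewrite invr_gt0.
move=> G k p simpG p01 [N1 kG] [N2 aG] [N3 pG]; apply: aas_of_le.
  by exists 0%N => n _; exact: prob_union_le1.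
move=> eps eps0.
pose N4 := (Num.truncn (expR 1 ^+ 2 / eps)).+1.
exists (maxn (maxn 3 N1) (maxn (maxn N2 N3) N4)) => n.
rewrite !geq_max => /andP[/andP[n3 /kG kn] /andP[/andP[/aG an /pG pn] n4]].
rewrite -kn in an pn.
have a1 : (0 < alpha (G n))%N := alpha_gt0 _ (Ordinal n3).
have at0 : 1000 * t0 * (alpha (G n))%:R <= (mindeg (G n))%:R.
  by move: an; rewrite mulrC ler_pdivlMr // mulrC.
have aR : 1 <= (alpha (G n))%:R :> R by rewrite ler1n.
have at2 : 2 * t0 * (alpha (G n))%:R <= (mindeg (G n))%:R.
  by apply: le_trans at0; apply: ler_wpM2r; lra.
have k1000 : (1000 * alpha (G n) <= mindeg (G n))%N.
  rewrite -(ler_nat R) natrM; apply: le_trans at0.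
  by apply: ler_wpM2r; lra.
have k0 : (0 < mindeg (G n))%N by apply: leq_trans k1000; rewrite muln_gt0 a1.
have n0 : (0 < n)%N by apply: leq_trans n3.
apply: le_trans (_ : 1 - expR 1 ^+ 2 / n%:R <= _).
  rewrite lerD2l lerN2 ler_pdivrMr ?ltr0n // mulrC -ler_pdivrMr //.
  by apply: ltW; apply: lt_le_trans (truncnS_gt _) _; rewrite ler_nat.
(* [F S] counts the bad cuts avoided by [S]; a value below 1 means that there are none. *)
pose F (S : graph n) : R := \sum_(u : {set 'I_n} * {set 'I_n} | bad_cut (G n) t0 u.1 u.2)
  ([disjoint S & cut_of (G n) u.1 u.2])%:R.
apply: le_trans (prob_union_ge (f := F) (p01 n) _); last first.
  move=> S SP; rewrite {}/F; set f := \sum_(u | _) _.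
  suff : f < 1 -> pancyclic (G n :|: S).
    case: (ltP f 1) => [_ /(_ isT)-> |f1 _]; first by rewrite lerBlDr lerDl; apply: sumr_ge0.
    by apply: le_trans (ler0n _ _); rewrite subr_le0.
  move=> f1; apply: pancyclic_of_hamiltonian; last first.
    apply: leq_trans (mindegU _ _); apply: leq_trans k1000; rewrite leq_mul2l; exact: alphaU.
  apply: toughH => //; first by rewrite /simple_graph subUset SP andbT; exact: simpG.
  apply: (tough_of_no_cut t1 at2) => A Q bad; apply: contraTN f1 => dis.
  rewrite -leNgt /f (bigD1 (A, Q)) //= dis lerDl; exact: sumr_ge0.
by rewrite lerD2l lerN2; exact: prob_bad_cut.
Qed.

Theorem theorem1p5 (R : realType) :
  (* (a) *)
  (forall t0 : R, 1 <= t0 ->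
    (forall (n : nat) (E : graph n), simple_graph E -> (3 <= n)%N ->
        tough E t0 -> hamiltonian E) ->
    exists c1 c2 : R, 0 < c1 /\ 0 < c2 /\
      forall (G : forall n : nat, graph n) (k : nat -> nat) (p : nat -> R),
        (forall n, simple_graph (G n)) ->
        (forall n, 0 <= p n <= 1) ->
        ev (fun n => mindeg (G n) = k n) ->
        ev (fun n => (alpha (G n))%:R <= c2 * (k n)%:R) ->
        ev (fun n => c1 * ln (n%:R) / (n%:R * (k n)%:R) <= p n) ->
        aas (fun n => prob_union (G n) (p n) (@pancyclic n)))
  /\
  (* (b) *)
  (forall (eps c : R), 0 < eps < 1 / 2 -> 0 < c < 1 ->
    forall k : nat -> nat,
      ev (fun n => n%:R `^ eps <= (k n)%:R <= n%:R `^ (1 - eps)) ->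
      exists c' : R, 0 < c' /\
      exists H : forall n : nat, graph n,
        (forall n, simple_graph (H n)) /\
        ev (fun n => mindeg (H n) = k n /\ (alpha (H n))%:R <= c * (k n)%:R) /\
        forall p : nat -> R,
          (forall n, 0 <= p n <= 1) ->
          ev (fun n => p n <= c' * ln (n%:R) / (n%:R * (k n)%:R)) ->
          aas (fun n => prob_union (H n) (p n) (fun E => ~~ hamiltonian E)))
  /\
  (* (c) *)
  (forall k : nat -> nat,
    ev (fun n => (2 * k n <= n)%N) ->
    (forall M : nat, ev (fun n => (M <= k n)%N)) ->
    exists H : forall n : nat, graph n,
      (forall n, simple_graph (H n)) /\
      ev (fun n => alpha (H n) = k n /\ (k n <= 2 * mindeg (H n))%N) /\
      forall p : nat -> R,
        (forall n, 0 <= p n <= 1) ->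
        ev (fun n => p n <= 1 / (3 * n%:R)) ->
        aas (fun n => prob_union (H n) (p n) (fun E => ~~ hamiltonian E))).
Proof.
split; first by move=> t0; exact: pancyclic_above_log.
split; first by move=> eps c; exact: not_hamiltonian_below_log.
exact: not_hamiltonian_below_linear.
Qed.
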